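(* For every $t\in V(G)\setminus\{s\}$, $S_{\sigma(t)}^t\subseteq E(H)$. Moreover, $H$ has exactly $\sum_{t\in V(G)\setminus\{s\}}\sigma(t)$ edges, and this is optimal: every subgraph of $G$ that contains, for each $t\in V(G)\setminus\{s\}$, $\sigma(t)$ pairwise edge-disjoint $s$–$t$ paths of minimum total cost in $G$ has at least $\sum_{t\in V(G)\setminus\{s\}}\sigma(t)$ edges.
   Context: $G$ is a directed graph with vertex set $V(G)$, edge set $E(G)$, non-negative edge costs $c$ (anti-symmetric), $s\in V(G)$ a source and $p$ a positive integer; $G$ need not be $p$-edge-outconnected from $s$. For $t\ne s$, $\lambda(t)$ is the maximum number of pairwise edge-disjoint $s$–$t$ paths in $G$ and $\sigma(t)=\min\{\lambda(t),p\}$. Let $M>c(E(G))$. The graph $G'$ is obtained from $G$ by adding $p$ new vertices $v_1,\dots,v_p$, all edges $(v_j,v_k)$ for $j\ne k$, all edges $(s,v_j)$, and all edges $(v_j,x)$ for $x\in V(G)\setminus\{s\}$, each new edge having cost $M$ (parallel/antiparallel edges are treated as distinct). Apply to $G'$ (which is $p$-edge-outconnected from $s$) the following construction: $H'_0=(V(G'),\emptyset)$; for $i=1,\dots,p$: for each $t\neq s$ in $G'$ let $S_{i-1}^t$ be the edge set of $i-1$ pairwise edge-disjoint $s$–$t$ paths contained in $H'_{i-1}$ of minimum total cost among all such families in $G'$ ($S_0^t=\emptyset$); let $G_{i-1}^t$ be $G'$ with each $(u,v)\in S_{i-1}^t$ replaced by $(v,u)$ of cost $-c(u,v)$; for a path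 $\pi$ let $\eta(\pi)$ be its number of edges in $E(G')\setminus E(H'_{i-1})$ (original orientation) and order paths lexicographically by $(c(\pi),\eta(\pi))$; for each $t\ne s$ choose arbitrarily an $s$–$t$ path in $G_{i-1}^t$ minimal in this order, and let $H'_i$ be $H'_{i-1}$ plus the last edges of all chosen paths. Finally, for $1\le i\le p$ and $t\neq s$, $S_i^t$ is the edge set of $i$ pairwise edge-disjoint $s$–$t$ paths contained in $H'_i$ of minimum total cost among all such families in $G'$. $H$ is obtained from $H'_p$ by deleting the dummy vertices $v_1,\dots,v_p$ and all incident edges.
   Formalization: The exact edge count of H is stated only if all edge costs of G are positive or ties for (c,η) are broken towards paths with fewest edges; with zero-cost edges and arbitrary ties it fails (V={s,x,t}, single edge (x,t) of cost 0, p=2). *)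

(* Defs.v *)
From mathcomp Require Import all_boot all_order all_algebra.

Set Implicit Arguments.
Unset Strict Implicit.
Unset Printing Implicit Defensive.

Import Order.TTheory GRing.Theory Num.Theory.
Local Open Scope ring_scope.

(* Edges carry an identity of their own, so that an edge is never confused
   with a parallel or antiparallel one.  A simple digraph is the case where
   e |-> (src e, tgt e) is injective. *)
Record digraph := Digraph {
  vertex : finType;
  edge : finType;
  src : edge -> vertex;
  tgt : edge -> vertex
}.

Fixpoint walk (G : digraph) (x : vertex G) (q : seq (edge G)) (y : vertex G)
    : bool :=
  if q is e :: q' then (src e == x) && walk (tgt e) q' y else x == y.

Definition is_path (G : digraph) (x y : vertex G) (q : seq (edge G)) : bool :=
  walk x q y && uniq (x :: map (@tgt G) q).

Definition path_cost (R : realFieldType) (G : digraph) (c : edge G -> R)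
    (q : seq (edge G)) : R :=
  \sum_(e <- q) c e.

Definition disjoint_paths (G : digraph) (s t : vertex G) (k : nat)
    (Q : 'I_k -> seq (edge G)) : Prop :=
  (forall i, is_path s t (Q i)) /\
  (forall i j, i != j -> [disjoint Q i & Q j]).

Definition family_edges (G : digraph) (k : nat) (Q : 'I_k -> seq (edge G))
    : {set edge G} :=
  \bigcup_i [set e in Q i].

Definition family_cost (R : realFieldType) (G : digraph) (c : edge G -> R)
    (k : nat) (Q : 'I_k -> seq (edge G)) : R :=
  \sum_i path_cost c (Q i).

Definition min_cost_paths (R : realFieldType) (G : digraph) (c : edge G -> R)
    (s t : vertex G) (k : nat) (Q : 'I_k -> seq (edge G)) : Prop :=
  disjoint_paths s t Q /\
  (forall Q' : 'I_k -> seq (edge G),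
     disjoint_paths s t Q' -> family_cost c Q <= family_cost c Q').

Definition max_disjoint_paths (G : digraph) (s t : vertex G) (l : nat) : Prop :=
  (exists Q : 'I_l -> seq (edge G), disjoint_paths s t Q) /\
  (forall (k : nat) (Q : 'I_k -> seq (edge G)),
     disjoint_paths s t Q -> (k <= l)%N).

(* F is a legitimate S_k^t with respect to the edge set H: the families lie in
   H, but the minimum is taken over all families of the ambient digraph G. *)
Definition min_cost_edge_set (R : realFieldType) (G : digraph) (c : edge G -> R)
    (s t : vertex G) (k : nat) (H F : {set edge G}) : Prop :=
  exists Q : 'I_k -> seq (edge G),
    [/\ min_cost_paths c s t Q, family_edges Q = F & F \subset H].

(* The residual digraph keeps the edge type: an edge in S denotes there its
   reversed copy, of opposite cost. *)
Definition residual (G : digraph) (S : {set edge G}) : digraph :=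
  @Digraph (vertex G) (edge G)
    (fun e => if e \in S then tgt e else src e)
    (fun e => if e \in S then src e else tgt e).

Definition residual_cost (R : realFieldType) (G : digraph) (c : edge G -> R)
    (S : {set edge G}) (e : edge G) : R :=
  if e \in S then - c e else c e.

(* Reversed edges are not edges of G and so do not count. *)
Definition eta (G : digraph) (H S : {set edge G}) (q : seq (edge G)) : nat :=
  count (fun e => (e \notin S) && (e \notin H)) q.

Definition lex_min_path (R : realFieldType) (G : digraph) (c : edge G -> R)
    (s t : vertex G) (H S : {set edge G}) (q : seq (edge G)) : Prop :=
  @is_path (residual S) s t q /\
  (forall q' : seq (edge G), @is_path (residual S) s t q' ->
     path_cost (residual_cost c S) q < path_cost (residual_cost c S) q' \/
     path_cost (residual_cost c S) q = path_cost (residual_cost c S) q' /\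
     (eta H S q <= eta H S q')%N).

Definition last_edges (G : digraph) (s : vertex G)
    (P : vertex G -> seq (edge G)) : {set edge G} :=
  [set e | [exists t, (t != s) && (ohead (rev (P t)) == Some e)]].

(* The first k rounds, for arbitrary choices; round i.+1 goes from H i to
   H i.+1 by means of the edge sets S i t and the paths P i t.  The values of
   H, S and P that k rounds do not reach are unconstrained. *)
Definition run (R : realFieldType) (G : digraph) (c : edge G -> R)
    (s : vertex G) (k : nat) (H : nat -> {set edge G})
    (S : nat -> vertex G -> {set edge G})
    (P : nat -> vertex G -> seq (edge G)) : Prop :=
  H 0%N = set0 /\
  (forall i : nat, (i < k)%N ->
     [/\ forall t, t != s -> min_cost_edge_set c s t i (H i) (S i t),
         forall t, t != s -> lex_min_path c s t (H i) (S i t) (P i t)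
       & H i.+1 = H i :|: last_edges s (P i)]).

(* Whatever the earlier choices, the next edge sets S k t and, before the last
   round, the next paths P k t exist. *)
Definition never_stuck (R : realFieldType) (G : digraph) (c : edge G -> R)
    (s : vertex G) (p : nat) : Prop :=
  forall (k : nat) (H : nat -> {set edge G})
         (S : nat -> vertex G -> {set edge G})
         (P : nat -> vertex G -> seq (edge G)),
    (k <= p)%N -> run c s k H S P ->
    forall t, t != s ->
      (exists F, min_cost_edge_set c s t k (H k) F) /\
      ((k < p)%N -> forall F, min_cost_edge_set c s t k (H k) F ->
         exists q, lex_min_path c s t (H k) F q).

(* Among the paths that are minimal for (cost, eta), each chosen one has the
   fewest edges.  Arbitrary ties are harmless when all costs are positive; an
   edge (x,t) of cost 0 may make s,v_j,x,t tie with s,v_k,t, and choosing the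
   former would add (x,t) although t needs no further edge of G. *)
Definition shortest_ties (R : realFieldType) (G : digraph) (c : edge G -> R)
    (s : vertex G) (k : nat) (H : nat -> {set edge G})
    (S : nat -> vertex G -> {set edge G})
    (P : nat -> vertex G -> seq (edge G)) : Prop :=
  forall (i : nat) (t : vertex G) (q : seq (edge G)), (i < k)%N -> t != s ->
    lex_min_path c s t (H i) (S i t) q -> (size (P i t) <= size q)%N.

(* The edges are, in this order, those of G, the (v_j,v_k) with j != k, the
   (s,v_j), and the (v_j,x) with x != s. *)
Definition aug_vertex (G : digraph) (p : nat) : finType := (vertex G + 'I_p)%type.

Definition aug_edge (G : digraph) (s : vertex G) (p : nat) : finType :=
  (edge G + {jk : 'I_p * 'I_p | jk.1 != jk.2} + 'I_p
   + 'I_p * {x : vertex G | x != s})%type.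

Definition aug_src (G : digraph) (s : vertex G) (p : nat) (e : aug_edge s p)
    : aug_vertex G p :=
  match e with
  | inl (inl (inl e0)) => inl (src e0)
  | inl (inl (inr jk)) => inr (val jk).1
  | inl (inr j) => inl s
  | inr (j, x) => inr j
  end.

Definition aug_tgt (G : digraph) (s : vertex G) (p : nat) (e : aug_edge s p)
    : aug_vertex G p :=
  match e with
  | inl (inl (inl e0)) => inl (tgt e0)
  | inl (inl (inr jk)) => inr (val jk).2
  | inl (inr j) => inr j
  | inr (j, x) => inl (val x)
  end.

Definition augment (G : digraph) (s : vertex G) (p : nat) : digraph :=
  Digraph (@aug_src G s p) (@aug_tgt G s p).

Definition aug_cost (R : realFieldType) (G : digraph) (s : vertex G) (p : nat)
    (c : edge G -> R) (M : R) (e : edge (augment s p)) : R :=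
  match e with
  | inl (inl (inl e0)) => c e0
  | _ => M
  end.

Definition old_vertex (G : digraph) (s : vertex G) (p : nat) (x : vertex G)
    : vertex (augment s p) := inl x.

Definition old_edge (G : digraph) (s : vertex G) (p : nat) (e : edge G)
    : edge (augment s p) := inl (inl (inl e)).

(* Every edge of augment s p outside the range of old_edge is incident to a
   dummy vertex. *)
Definition delete_dummies (G : digraph) (s : vertex G) (p : nat)
    (H : {set edge (augment s p)}) : {set edge G} :=
  [set e | old_edge s p e \in H].

(* Main.v *)
(* Sets of edges are treated as flows, with excess (in-degree minus out-degree)
   at each vertex.  For an optimal flow S, another flow differs from S by a
   symmetric difference, which is a flow of the residual digraph of S; paths and
   cycles found there by following unbalanced vertices drive all the exchanges.

   Write d(t) for the cost of the path chosen for t, where every edge outside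
   H_{i-1} is charged an extra infinitesimal.  If that path enters v <> t by an
   edge e outside H_{i-1}, then d(v) < d(t).  By induction on d(v) some optimal
   i-flow T to v lies in H_i, and an optimal i-flow F to t that uses e contains,
   relative to T, a cycle through e; cancelling it trades e for edges of H_i
   without increasing the cost.  Hence H_i contains an optimal i-flow to each t.
   The last edge chosen for t is always new, so that t has in-degree i in H_i.

   In the augmented digraph, an optimal flow of value k >= lambda(t) consists of
   lambda(t) paths of G and k - lambda(t) detours of cost 2M through dummies, so
   that exactly the first sigma(t) last edges at t belong to G.  Conversely,
   sigma(t) disjoint paths to t end with sigma(t) different edges. *)

Require Import Defs.
From mathcomp Require Import all_boot all_order all_algebra.
From mathcomp Require Import zify ring lra.

Set Implicit Arguments.
Unset Strict Implicit.
Unset Printing Implicit Defensive.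

Import Order.TTheory GRing.Theory Num.Theory.
Local Open Scope ring_scope.

(** * Symmetric differences and signed sums *)

Definition symd (T : finType) (A B : {set T}) : {set T} :=
  [set x | (x \in A) (+) (x \in B)].

Lemma in_symd (T : finType) (A B : {set T}) x :
  (x \in symd A B) = (x \in A) (+) (x \in B).
Proof. by rewrite inE. Qed.

Lemma symdK (T : finType) (A B : {set T}) : symd A (symd B A) = B.
Proof. by apply/setP=> x; rewrite !in_symd addbC addbK. Qed.

(** The same change is read from both ends: applying to [A] all of its difference from [B] except
    [C] amounts to undoing [C] in [B]. *)
Lemma symd_setD (T : finType) (A B C : {set T}) :
  C \subset symd B A -> symd A (symd B A :\: C) = symd B C.
Proof.
move=> /subsetP sC; apply/setP=> x; have := sC x; rewrite !inE.
by case: (x \in A); case: (x \in B); case: (x \in C) => //= /(_ isT).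
Qed.

(** With [g] a boundary or a cost, the signed sum over [D] is the excess or the cost of [D] in the
    residual digraph of [S]. *)
Lemma sum_symd (V : zmodType) (T : finType) (S D : {set T}) (g : T -> V) :
  \sum_(e in symd S D) g e =
    \sum_(e in S) g e + \sum_(e in D) (if e \in S then - g e else g e).
Proof.
rewrite big_mkcond [in X in X + _]big_mkcond [in X in _ + X]big_mkcond -big_split.
apply: eq_bigr => e _; rewrite in_symd /=.
by case: (e \in S); case: (e \in D); rewrite /= ?subrr ?addr0 ?add0r.
Qed.

Lemma sum_setD (V : zmodType) (T : finType) (A B : {set T}) (g : T -> V) :
  B \subset A -> \sum_(e in A :\: B) g e = \sum_(e in A) g e - \sum_(e in B) g e.
Proof.
move=> sBA; rewrite [X in _ = X - _](big_setID B) /= (setIidPr sBA).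
by rewrite addrAC subrr add0r.
Qed.

(** * Excess and paths *)

Section Excess.

Variable G : digraph.
Implicit Types (F : {set edge G}) (e : edge G) (v : vertex G) (q : seq (edge G)).

Definition boundary e v : int := (tgt e == v)%:Z - (src e == v)%:Z.

Definition excess F v : int := \sum_(e in F) boundary e v.

Lemma walk_cat x q1 q2 y :
  walk x (q1 ++ q2) y = walk x q1 (last x (map (@tgt G) q1))
                        && walk (last x (map (@tgt G) q1)) q2 y.
Proof.
elim: q1 x => [|e q1 IH] x /=; first by rewrite eqxx.
by rewrite IH andbA.
Qed.

Lemma walk_last x q y : walk x q y -> last x (map (@tgt G) q) = y.
Proof.
by elim: q x => [|e q IH] x /=; [move/eqP | case/andP=> _ /IH].
Qed.

Lemma walk_catI x q1 q2 y z : walk x q1 y -> walk y q2 z -> walk x (q1 ++ q2) z.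
Proof. by move=> w1 w2; rewrite walk_cat (walk_last w1) w1. Qed.

Lemma walk_boundary x q y v :
  walk x q y -> \sum_(e <- q) boundary e v = (y == v)%:Z - (x == v)%:Z.
Proof.
elim: q x => [|e q IH] x /=; first by rewrite big_nil => /eqP ->; rewrite subrr.
case/andP=> /eqP <- /IH; rewrite big_cons => ->.
by rewrite /boundary; lia.
Qed.

Lemma sum_seq_set (V : zmodType) (g : edge G -> V) q :
  uniq q -> \sum_(e in [set:: q]) g e = \sum_(e <- q) g e.
Proof.
by move=> uq; rewrite (big_uniq _ uq); apply: eq_bigl => e; rewrite inE.
Qed.

Lemma walk_excess x q y v :
  walk x q y -> uniq q -> excess [set:: q] v = (y == v)%:Z - (x == v)%:Z.
Proof. by move=> wq uq; rewrite /excess sum_seq_set // (walk_boundary _ wq). Qed.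

Lemma is_path_walk x y q : is_path x y q -> walk x q y.
Proof. by case/andP. Qed.

Lemma is_path_uniq x y q : is_path x y q -> uniq q.
Proof. by case/andP=> _ /= /andP[_ /map_uniq]. Qed.

Lemma is_path_cat x y q1 q2 : is_path x y (q1 ++ q2) ->
  exists z, is_path x z q1 /\ is_path z y q2.
Proof.
rewrite /is_path walk_cat -andbA => /and3P[w1 w2].
rewrite map_cat -cat_cons cat_uniq => /and3P[u1 h u2].
exists (last x (map (@tgt G) q1)); rewrite w1 w2 u1; split=> //=.
rewrite u2 andbT; apply: contra h => h; apply/hasP.
by exists (last x (map (@tgt G) q1)); rewrite ?mem_last.
Qed.

Lemma is_path_source x y q e : is_path x y q -> e \in q -> src e != y.
Proof.
move=> pq; have /andP[wq uq] := pq; move=> /splitPr eq.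
case: q / eq pq wq uq => q1 q2 pq wq uq.
case: (is_path_cat pq) => z [_ /andP[/= /andP[/eqP -> w2]]].
case/andP=> nz _; apply: contra nz => /eqP ->.
have := mem_last (tgt e) (map (@tgt G) q2).
by rewrite (walk_last w2).
Qed.

Lemma is_path_target x y q e : is_path x y q -> e \in q -> tgt e != x.
Proof.
case/andP=> _ /= /andP[nx _] eq; apply: contra nx => /eqP <-.
exact: map_f.
Qed.

Lemma is_path_last x y q e : is_path x y (rcons q e) -> tgt e = y.
Proof. by case/andP=> /walk_last; rewrite map_rcons last_rcons. Qed.

Lemma is_path_tgt_end x y q e f :
  is_path x y (rcons q e) -> f \in rcons q e -> tgt f = y -> f = e.
Proof.
move=> pq fq tf; have te := is_path_last pq.
case/andP: pq => _ /= /andP[_]; rewrite map_rcons rcons_uniq te => /andP[ny _].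
move: fq; rewrite mem_rcons inE => /orP[/eqP //|fq].
by case/negP: ny; rewrite -tf map_f.
Qed.

Definition adj F : rel (vertex G) :=
  fun x y => [exists e in F, (src e == x) && (tgt e == y)].

Lemma connect_is_path F x y :
  connect (adj F) x y -> exists2 q, is_path x y q & {subset q <= F}.
Proof.
case/connectP=> p0 /shortenP[p pp up _] ->.
suff [q [wq mq sq]] : exists q, [/\ walk x q (last x p), map (@tgt G) q = p
    & {subset q <= F}] by exists q => //; rewrite /is_path wq mq.
elim: p x pp {up} => [|z p IH] x /=; first by exists [::]; rewrite /= eqxx; split.
case/andP=> /exists_inP[e eF /andP[sx /eqP tz]] /IH[q [wq mq sq]].
exists (e :: q); rewrite /= sx tz wq mq; split=> // f.
by rewrite inE => /orP[/eqP -> //|/sq].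
Qed.

Lemma sum_excess F (A : {set vertex G}) :
  \sum_(v in A) excess F v =
    \sum_(e in F) ((tgt e \in A)%:Z - (src e \in A)%:Z).
Proof.
rewrite /excess exchange_big; apply: eq_bigr => e _.
have mem1 (x : vertex G) : \sum_(v in A) ((x == v)%:Z) = (x \in A)%:Z.
  rewrite big_mkcond (bigD1 x) //= eqxx big1 ?addr0; first by case: (x \in A).
  by move=> v; rewrite eq_sym => /negPf ->; case: ifP.
by rewrite /boundary sumrB !mem1.
Qed.

(** No edge of [F] leaves the set of vertices reachable from [x], so its total excess is
    nonnegative. The deficit at [x] must be made up by a reachable vertex of positive excess. *)
Lemma excess_trace F x : excess F x < 0 ->
  exists y q, [/\ 0 < excess F y, is_path x y q & {subset q <= F}].
Proof.
move=> negx; pose A := [set y | connect (adj F) x y].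
have [/existsP[y /andP[]]|nopos] := boolP [exists y, (y \in A) && (0 < excess F y)].
  by rewrite inE => /connect_is_path[q pq sq] posy; exists y, q.
have : 0 <= \sum_(v in A) excess F v.
  rewrite sum_excess sumr_ge0 // => e eF.
  suff: src e \in A -> tgt e \in A by case: (src e \in A) => [->//|_]; case: (_ \in A).
  rewrite !inE => /connect_trans; apply; apply: connect1.
  by apply/exists_inP; exists e; rewrite ?eqxx.
rewrite (bigD1 x) /=; last by rewrite inE connect0.
suff: \sum_(v in A | v != x) excess F v <= 0.
  by move: negx; move: (excess F x) (\sum_(v in A | v != x) _) => a b ? ? ?; exfalso; lia.
apply: sumr_le0 => v /andP[vA _]; rewrite leNgt.
by apply: contra nopos => posv; apply/existsP; exists v; rewrite vA.
Qed.

Lemma excess_setD1 F e v : e \in F -> excess (F :\ e) v = excess F v - boundary e v.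
Proof. by move=> eF; rewrite [in RHS]/excess (big_setD1 e) //= addrAC subrr add0r. Qed.

(** Let [A] be the set of vertices that reach [src e] without [e]. If [tgt e] lies in [A], a cycle
    through [e] closes. Otherwise no edge of [F] enters [A] while [e] leaves it, so some vertex of
    [A] has negative excess. *)
Lemma excess_trace_back F e : e \in F ->
  (exists q, is_path (tgt e) (src e) q /\ {subset q <= F :\ e}) \/
  (exists x q, [/\ excess F x < 0, is_path x (tgt e) (rcons q e)
                 & {subset rcons q e <= F}]).
Proof.
move=> eF; pose A := [set y | connect (adj (F :\ e)) y (src e)].
have [vA|vA] := boolP (tgt e \in A).
  by left; move: vA; rewrite inE => /connect_is_path[q]; exists q.
right; have uA : src e \in A by rewrite inE connect0.
have [/existsP[x /andP[xA negx]]|noneg] :=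
    boolP [exists x, (x \in A) && (excess F x < 0)].
  move: (xA); rewrite inE => /connect_is_path[q pq sq]; exists x, q; split=> //.
    have /andP[wq uq] := pq; rewrite /is_path -cats1 (walk_catI wq) /= ?eqxx //.
    (* Every vertex of [q] reaches [src e] along the rest of [q], so it lies in [A], whereas [tgt e]
       does not. *)
    have u1 : uniq (rcons (x :: map (@tgt G) q) (tgt e)).
      rewrite rcons_uniq uq andbT; apply: contra vA.
      rewrite inE => /orP[/eqP -> //|/mapP[f fq ->]].
      rewrite inE; move: fq pq => /splitPr eq; case: q / eq sq wq uq => q1 q2 sq _ _.
      rewrite -cat_rcons => /is_path_cat[z [p1 p2]].
      rewrite (is_path_last p1); have {}sq g : g \in q2 -> g \in F :\ e.
        by move=> gq; apply: sq; rewrite mem_cat inE gq !orbT.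
      move/is_path_walk: p2; elim: q2 {p1} z sq => [|g q2 IH] a sq /=.
        by move=> /eqP ->; apply: connect0.
      case/andP=> sg wg; apply: (connect_trans (y := tgt g)).
        apply: connect1; apply/exists_inP; exists g; rewrite ?sg ?eqxx //.
        by apply: sq; rewrite inE eqxx.
      by apply: IH => // h hq; apply: sq; rewrite inE hq orbT.
    by rewrite map_cat cats1.
  move=> f; rewrite mem_rcons inE => /orP[/eqP -> //|/sq].
  by rewrite inE => /andP[].
have : \sum_(v in A) excess (F :\ e) v <= 0.
  rewrite sum_excess sumr_le0 // => f fF.
  suff: tgt f \in A -> src f \in A by case: (tgt f \in A) => [->//|_]; case: (_ \in A).
  rewrite !inE => c; apply: (connect_trans _ c); apply: connect1.
  by apply/exists_inP; exists f; rewrite ?eqxx.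
rewrite (eq_bigr _ (fun v _ => excess_setD1 v eF)) sumrB.
have -> : \sum_(v in A) boundary e v = -1.
  have <- : \sum_(v in A) excess [set e] v = -1.
    by rewrite sum_excess big_set1 (negPf vA) uA.
  by apply: eq_bigr => v _; rewrite /excess big_set1.
have : 0 <= \sum_(v in A) excess F v.
  apply: sumr_ge0 => v vA'; rewrite leNgt; apply: contra noneg => h.
  by apply/existsP; exists v; rewrite vA'.
by move: (\sum_(v in A) excess F v) => a ? ?; exfalso; lia.
Qed.

End Excess.

(** * Optimal flows and the residual digraph *)

Section Flow.

Variable G : digraph.
Implicit Types (F : {set edge G}) (e : edge G) (v : vertex G) (q : seq (edge G)).

Definition flow (s t : vertex G) (k : nat) F : Prop :=
  forall v, excess F v = k%:Z * ((t == v)%:Z - (s == v)%:Z).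

Lemma excess_setD F F' v : F' \subset F -> excess (F :\: F') v = excess F v - excess F' v.
Proof. exact: sum_setD. Qed.

Lemma seq_subset q F : {subset q <= F} -> [set:: q] \subset F.
Proof. by move=> sq; apply/subsetP=> e; rewrite inE => /sq. Qed.

(** Paths traced from [s] can only end in [t], and removing one preserves the hypotheses with [k]
    lowered by one. Negative excess at further vertices is allowed, because it occurs once the
    dummies are removed from a flow. *)
Lemma flow_paths s t k F :
  s != t -> (forall y, 0 < excess F y -> y = t) -> excess F s <= - k%:Z ->
  exists Q : 'I_k -> seq (edge G), disjoint_paths s t Q /\ family_edges Q \subset F.
Proof.
move=> st; elim: k F => [|k IH] F pos neg.
  exists (fun=> [::]); split; first by split=> [[] | []].
  by apply/bigcupsP; case.
have [|y [q [py pq sq]]] := @excess_trace _ F s; first lia.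
have ty := pos _ py; subst y; have sqF := seq_subset sq.
have exD v : excess (F :\: [set:: q]) v = excess F v - ((t == v)%:Z - (s == v)%:Z).
  by rewrite excess_setD // (walk_excess _ (is_path_walk pq)) ?(is_path_uniq pq).
case: (IH (F :\: [set:: q])) => [y||Q [[pQ dQ] sQ]].
- rewrite exD => h; apply: pos; move: h; case: eqP => _; first by case: eqP => _; lia.
  by case: eqP => [<-|_]; lia.
- by rewrite exD eqxx eq_sym (negPf st); lia.
have dq i : [disjoint q & Q i].
  rewrite disjoint_subset; apply/subsetP=> e eq; rewrite inE; apply/negP=> eQ.
  have /(subsetP sQ) : e \in family_edges Q by apply/bigcupP; exists i; rewrite ?inE.
  by rewrite !inE eq.
exists (fun i => if unlift ord0 i is Some j then Q j else q); split; [split|].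
- by move=> i; case: unliftP => [j|] _; rewrite ?pQ.
- move=> i j; case: unliftP => [i'|] ->; case: unliftP => [j'|] ->.
  + by rewrite (inj_eq lift_inj); apply: dQ.
  + by move=> _; rewrite disjoint_sym; apply: dq.
  + by move=> _; apply: dq.
  + by rewrite eqxx.
apply/bigcupsP=> i _; case: unliftP => [j|] _.
  apply: (subset_trans _ (subset_trans sQ (subsetDl _ _))).
  exact: (bigcup_sup j).
by apply/subsetP=> e; rewrite inE => /sq.
Qed.

Lemma sum_family_edges (V : zmodType) (g : edge G -> V) s t k
    (Q : 'I_k -> seq (edge G)) :
  disjoint_paths s t Q ->
  \sum_(e in family_edges Q) g e = \sum_i \sum_(e <- Q i) g e.
Proof.
case=> pQ dQ; rewrite partition_disjoint_bigcup => [|i j ij].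
  by apply: eq_bigr => i _; rewrite sum_seq_set // (is_path_uniq (pQ i)).
move: (dQ i j ij); rewrite !disjoint_subset => /subsetP h.
by apply/subsetP=> e; have := h e; rewrite !inE.
Qed.

Lemma disjoint_paths_flow s t k (Q : 'I_k -> seq (edge G)) :
  disjoint_paths s t Q -> flow s t k (family_edges Q).
Proof.
move=> dQ v; rewrite /excess (sum_family_edges _ dQ).
rewrite (eq_bigr (fun=> (t == v)%:Z - (s == v)%:Z)) => [|i _].
  by rewrite sumr_const card_ord -mulr_natl natz.
by rewrite (walk_boundary _ (is_path_walk (dQ.1 i))).
Qed.

Definition indegree F v : nat := #|[set e in F | tgt e == v]|.

Lemma family_source s t k (Q : 'I_k -> seq (edge G)) e :
  disjoint_paths s t Q -> e \in family_edges Q -> src e != t.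
Proof.
by move=> [pQ _] /bigcupP[i _]; rewrite inE; apply: is_path_source.
Qed.

Lemma excess_sink F v :
  (forall e, e \in F -> src e != v) -> excess F v = (indegree F v)%:Z.
Proof.
move=> h; rewrite /excess /indegree -sum1_card -natz natr_sum big_mkcond.
rewrite [RHS]big_mkcond; apply: eq_bigr => e _; rewrite inE /boundary.
by case: ifP => //= /h /negPf ->; case: eqP.
Qed.

Lemma indegree_family s t k (Q : 'I_k -> seq (edge G)) :
  s != t -> disjoint_paths s t Q -> indegree (family_edges Q) t = k.
Proof.
move=> st dQ; have := excess_sink (fun e => family_source dQ (e := e)).
by rewrite (disjoint_paths_flow dQ) eqxx (negPf st); lia.
Qed.

End Flow.

(** * Optimality and shortest residual paths *)

Section Optimality.

Variables (R : realFieldType) (G : digraph).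
Implicit Types (F S D : {set edge G}) (c : edge G -> R).

(** The competitors are arbitrary edge sets of equal excess rather than families of paths, so the
    notion also covers flows with several sinks and can be tested by symmetric differences. *)
Definition optimal c F : Prop :=
  forall F', excess F' =1 excess F -> \sum_(e in F) c e <= \sum_(e in F') c e.

Lemma sum_subset c F F' :
  (forall e, 0 <= c e) -> F \subset F' -> \sum_(e in F) c e <= \sum_(e in F') c e.
Proof.
by move=> hc sF; rewrite -subr_ge0 -sum_setD // sumr_ge0.
Qed.

Lemma family_costE c s t k (Q : 'I_k -> seq (edge G)) :
  disjoint_paths s t Q -> family_cost c Q = \sum_(e in family_edges Q) c e.
Proof. by move=> dQ; rewrite (sum_family_edges _ dQ). Qed.

(** A competing edge set contains [k] disjoint paths, and what is left over has nonnegative cost. *)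
Lemma min_cost_optimal c s t k (Q : 'I_k -> seq (edge G)) :
  (forall e, 0 <= c e) -> s != t -> min_cost_paths c s t Q ->
  optimal c (family_edges Q).
Proof.
move=> hc st [dQ mQ] F' exF'; have fQ := disjoint_paths_flow dQ.
have [||Q' [dQ' sQ']] := @flow_paths _ s t k F' st.
- by move=> y; rewrite exF' fQ; case: eqP => [//|_]; case: eqP; lia.
- by rewrite exF' fQ eqxx eq_sym (negPf st); lia.
apply: le_trans (sum_subset hc sQ'); rewrite -!(family_costE c (s := s) (t := t)) //.
exact: mQ.
Qed.

Lemma optimal_min_cost c s t k F :
  (forall e, 0 <= c e) -> s != t -> flow s t k F -> optimal c F ->
  exists Q : 'I_k -> seq (edge G),
    min_cost_paths c s t Q /\ family_edges Q \subset F.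
Proof.
move=> hc st fF oF; have [||Q [dQ sQ]] := @flow_paths _ s t k F st.
- by move=> y; rewrite fF; case: eqP => [//|_]; case: eqP; lia.
- by rewrite fF eqxx eq_sym (negPf st); lia.
exists Q; split=> //; split=> // Q' dQ'; rewrite (family_costE _ dQ) (family_costE _ dQ').
apply: (le_trans (sum_subset hc sQ)); apply: oF => v.
by rewrite fF (disjoint_paths_flow dQ').
Qed.

Lemma excess_symd S D v :
  excess (symd S D) v = excess S v + @excess (residual S) D v.
Proof.
rewrite /excess sum_symd; congr (_ + _); apply: eq_bigr => e _.
by rewrite /boundary /=; case: ifP; rewrite ?opprB.
Qed.

Lemma cost_symd c S D : \sum_(e in symd S D) c e =
  \sum_(e in S) c e + \sum_(e in D) residual_cost c S e.
Proof. exact: sum_symd. Qed.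

Lemma residual_circulation_ge0 c S D :
  optimal c S -> @excess (residual S) D =1 (fun=> 0) ->
  0 <= \sum_(e in D) residual_cost c S e.
Proof.
move=> oS D0; have /oS : excess (symd S D) =1 excess S.
  by move=> v; rewrite excess_symd D0 addr0.
by rewrite cost_symd lerDl.
Qed.

Lemma path_costE c (q : seq (edge G)) :
  uniq q -> path_cost c q = \sum_(e in [set:: q]) c e.
Proof. by move=> uq; rewrite sum_seq_set. Qed.

Lemma path_cost_cat c (q1 q2 : seq (edge G)) :
  path_cost c (q1 ++ q2) = path_cost c q1 + path_cost c q2.
Proof. exact: big_cat. Qed.

Lemma residual_cycle_ge0 c S x q :
  optimal c S -> uniq q -> @walk (residual S) x q x ->
  0 <= path_cost (residual_cost c S) q.
Proof.
move=> oS uq wq; rewrite path_costE //; apply: residual_circulation_ge0 => // v.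
by rewrite (walk_excess _ wq) // subrr.
Qed.

(** The walk is shortened from its end. If prepending an edge makes the path return to its first
    vertex, the closed part is a residual cycle, of nonnegative cost, and is cut off. *)
Lemma residual_walk_path c S x y q :
  optimal c S -> @walk (residual S) x q y ->
  exists2 q', @is_path (residual S) x y q' &
    path_cost (residual_cost c S) q' <= path_cost (residual_cost c S) q.
Proof.
move=> oS; elim: q x => [|e q IH] x /=.
  by move=> /eqP ->; exists [::]; rewrite // /is_path /= eqxx.
case/andP=> /eqP sx /IH[q' pq' cq'].
have le1 : path_cost (residual_cost c S) (e :: q') <= path_cost (residual_cost c S) (e :: q).
  by rewrite /path_cost !big_cons lerD2l.
have /andP[wq' uq'] := pq'.
have wx : @walk (residual S) x (e :: q') y by rewrite /= sx eqxx.
have [xin|xout] := boolP (x \in (map (@tgt (residual S)) (e :: q'))); last first.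
  by exists (e :: q') => //; rewrite /is_path wx /= xout.
case/mapP: xin => f; move: wx uq' le1 => /[swap].
rewrite -[_ :: map _ _]/(map (@tgt (residual S)) (e :: q')).
move=> /[swap] w u l fq tf; move: fq w u l => /splitPr eq.
case: (e :: q') / eq => q1 q2; rewrite -cat_rcons => w u l.
have lx : last x (map (@tgt (residual S)) (rcons q1 f)) = x.
  by rewrite map_rcons last_rcons.
rewrite walk_cat lx in w; case/andP: w => w1 w2.
rewrite map_cat cat_uniq in u; case/and3P: u => u1 u12 u2.
exists q2; last first.
  apply: le_trans l; rewrite path_cost_cat lerDr.
  exact: (residual_cycle_ge0 oS (map_uniq u1) w1).
rewrite /is_path w2 /= u2 andbT; apply: contra u12 => h; apply/hasP; exists x => //.
by rewrite map_rcons mem_rcons inE /= tf eqxx.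
Qed.

Definition shortest (c : edge G -> R) S (x y : vertex G) (q : seq (edge G)) : Prop :=
  @is_path (residual S) x y q /\
  (forall q', @is_path (residual S) x y q' ->
     path_cost (residual_cost c S) q <= path_cost (residual_cost c S) q').

(** A cheaper prefix followed by [q2] may repeat vertices, but this walk shortens to a path at no
    extra cost. *)
Lemma shortest_prefix c S x y z q1 q2 :
  optimal c S -> shortest c S x y (q1 ++ q2) ->
  @is_path (residual S) x z q1 -> @is_path (residual S) z y q2 ->
  shortest c S x z q1.
Proof.
move=> oS [p12 m12] p1 p2; split=> // q pq.
have := walk_catI (is_path_walk pq) (is_path_walk p2).
case/(residual_walk_path oS) => q' /m12 le1 le2.
by have := le_trans le1 le2; rewrite !path_cost_cat lerD2r.
Qed.

Lemma excess_symd_path S x y q v : @is_path (residual S) x y q ->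
  excess (symd S [set:: q]) v = excess S v + ((y == v)%:Z - (x == v)%:Z).
Proof.
by move=> pq; rewrite excess_symd (walk_excess _ (is_path_walk pq)) ?(is_path_uniq pq).
Qed.

(** A competitor differs from [S] by a residual flow of value one. That flow contains a path from
    [x] to [y], at least as costly as [q], and the remainder is a circulation of nonnegative
    cost. *)
Lemma shortest_optimal c S x y q : x != y ->
  optimal c S -> shortest c S x y q -> optimal c (symd S [set:: q]).
Proof.
move=> xy oS [pq mq] F exF; pose D := symd F S.
have FE : F = symd S D by rewrite symdK.
have exD v : @excess (residual S) D v = (y == v)%:Z - (x == v)%:Z.
  have := exF v; rewrite (excess_symd_path _ pq) FE excess_symd.
  by move/addrI.
have [|y' [q' [py' pq' sq']]] := @excess_trace (residual S) D x.
  by rewrite exD eqxx eq_sym (negPf xy).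
have ? : y' = y by move: py'; rewrite exD; case: eqP => [//|_]; case: eqP; lia.
subst y'; rewrite cost_symd {}FE cost_symd lerD2l -path_costE ?(is_path_uniq pq) //.
apply: (le_trans (mq _ pq')); rewrite path_costE ?(is_path_uniq pq') //.
have sD : [set:: q'] \subset D := seq_subset sq'.
rewrite -subr_ge0 -sum_setD //; apply: residual_circulation_ge0 => // v.
rewrite (@excess_setD (residual S)) // exD (walk_excess _ (is_path_walk pq')).
  by rewrite subrr.
exact: is_path_uniq pq'.
Qed.

(* Joined to the flow of [S], the path leaves a flow from [x] to [t] whose
   removal gives back a flow with the demands of [S]. *)
Lemma residual_to_sink_ge0 c S s t k x q :
  (forall e, 0 <= c e) -> flow s t k S -> optimal c S ->
  @is_path (residual S) x t q -> 0 <= path_cost (residual_cost c S) q.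
Proof.
move=> hc fS oS pq; have uq := is_path_uniq pq.
have [xt|xt] := eqVneq x t.
  by subst x; apply: residual_cycle_ge0 (is_path_walk pq).
have exF v := excess_symd_path v pq.
have [|y [p [py pp sp]]] := @excess_trace _ (symd S [set:: q]) x.
  by rewrite exF fS eqxx eq_sym (negPf xt); case: eqP => _ /=; lia.
have ? : y = t.
  move: py; rewrite exF fS; case: eqP => [//|_].
  by case: (s == y); case: (x == y) => /=; lia.
subst y; have sF := seq_subset sp.
have /oS : excess (symd S [set:: q] :\: [set:: p]) =1 excess S.
  move=> v; rewrite excess_setD // exF (walk_excess _ (is_path_walk pp)) ?(is_path_uniq pp) //.
  by rewrite addrK.
move/le_trans/(_ (sum_subset hc (subsetDl _ _))).
by rewrite cost_symd lerDl path_costE.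
Qed.

End Optimality.

(** * A perturbed cost for the lexicographic order *)

Lemma size_is_path (G : digraph) (x y : vertex G) (q : seq (edge G)) :
  is_path x y q -> (size q <= #|vertex G|)%N.
Proof.
case/andP=> _ uq; have := card_uniqP uq; rewrite /= size_map => h.
by apply: ltnW; rewrite -h max_card.
Qed.

Section Penalty.

Variables (R : realFieldType) (G : digraph) (c : edge G -> R).
Implicit Types (F S D H : {set edge G}).

(* For [eps] below the least gap between the costs of two edge sets, [penalized]
   orders the residual paths as (cost, eta) does lexicographically. *)
Definition penalized (eps : R) H (e : edge G) : R := c e + eps * (e \notin H)%:R.

(** The factor [#|edge G|] bounds [eta] on paths, so penalties never outweigh a difference of
    costs. *)
Definition gap (eps : R) : Prop :=
  0 < eps /\ forall A B : {set edge G}, \sum_(e in A) c e < \sum_(e in B) c e ->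
    \sum_(e in A) c e + eps * #|edge G|%:R < \sum_(e in B) c e.

Lemma positive_lower_bound (I : eqType) (r : seq I) (f : I -> R) :
  exists2 d, 0 < d & forall i, i \in r -> 0 < f i -> d < f i.
Proof.
elim: r => [|i r [d d0 hd]]; first by exists 1.
have [fi|fi] := ltP 0 (f i); last first.
  exists d => // j; rewrite inE => /orP[/eqP ->|]; last exact: hd.
  by rewrite ltNge fi.
(* Halving keeps the bound strictly below [f i]. *)
exists (Num.min d (f i / 2)); first by rewrite lt_min d0 divr_gt0.
move=> j; rewrite inE gt_min => /orP[/eqP ->|jr] fj; last by rewrite hd.
by rewrite ltr_pdivrMr // mulr_natr mulr2n ltrDl fi orbT.
Qed.

Lemma gap_exists : exists eps, gap eps.
Proof.
pose f (AB : {set edge G} * {set edge G}) :=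
  \sum_(e in AB.2) c e - \sum_(e in AB.1) c e.
have [d d0 hd] := positive_lower_bound (enum {: {set edge G} * {set edge G}}) f.
(* The successor avoids division by zero and still gives [eps * #|edge G| <= d]. *)
exists (d / #|edge G|.+1%:R); split; first by rewrite divr_gt0 ?ltr0n.
move=> A B; rewrite -subr_gt0 => /(hd (A, B) (mem_enum _ _)); rewrite /f /= ltrBrDl.
apply: le_lt_trans; rewrite lerD2l mulrAC ler_pdivrMr ?ltr0n //.
by rewrite ler_wpM2l ?(ltW d0) // ler_nat.
Qed.

Lemma penalized_ge (eps : R) H e : 0 <= eps -> c e <= penalized eps H e.
Proof. by move=> e0; rewrite lerDl mulr_ge0. Qed.

Lemma penalized_optimal eps H S :
  0 <= eps -> S \subset H -> optimal c S -> optimal (penalized eps H) S.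
Proof.
move=> e0 /subsetP sH oS F /oS le1; apply: (le_trans _ (le_trans le1 _)).
  by apply: ler_sum => e /sH eH; rewrite /penalized eH mulr0 addr0.
by apply: ler_sum => e _; apply: penalized_ge.
Qed.

Lemma penalized_path_cost eps H S q : S \subset H ->
  path_cost (residual_cost (penalized eps H) S) q =
    path_cost (residual_cost c S) q + eps * (eta H S q)%:R.
Proof.
move=> /subsetP sH; rewrite /path_cost; elim: q => [|e q IH].
  by rewrite !big_nil mulr0 addr0.
rewrite !big_cons IH /= natrD mulrDr addrACA; congr (_ + _).
rewrite /residual_cost /penalized.
by case: ifP => [/sH -> | _] /=; rewrite ?mulr0 ?addr0.
Qed.

(** It turns residual path costs into differences of costs of edge sets, to which [gap] applies. *)
Lemma path_cost_symd S q : uniq q ->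
  path_cost (residual_cost c S) q =
    \sum_(e in symd S [set:: q]) c e - \sum_(e in S) c e.
Proof. by move=> uq; rewrite path_costE // cost_symd addrC addKr. Qed.

Lemma gap_path eps S q q' : gap eps -> uniq q -> uniq q' ->
  path_cost (residual_cost c S) q < path_cost (residual_cost c S) q' ->
  path_cost (residual_cost c S) q + eps * #|edge G|%:R
    < path_cost (residual_cost c S) q'.
Proof.
move=> [_ hg] uq uq'; rewrite !path_cost_symd // ltrD2r => /hg.
by rewrite addrAC ltrD2r.
Qed.

Lemma eta_le_card H S q : uniq q -> (eta H S q <= #|edge G|)%N.
Proof.
move=> uq; apply: (leq_trans (count_size _ _)).
by rewrite -(card_uniqP uq) max_card.
Qed.

(** Minimality for [c] makes the augmented flow optimal; minimality for the penalized cost serves to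
    compare the paths of different vertices. *)
Lemma lex_min_shortest eps s t H S q : gap eps -> S \subset H ->
  lex_min_path c s t H S q ->
  shortest c S s t q /\ shortest (penalized eps H) S s t q.
Proof.
move=> hg sH [pq mq]; have [e0 _] := hg; split; split=> // q' pq'.
  by case: (mq _ pq') => [/ltW //|[-> _]].
rewrite !penalized_path_cost //; case: (mq _ pq') => [lt1|[-> le1]]; last first.
  by rewrite lerD2l ler_wpM2l ?ler_nat // ltW.
have := gap_path hg (is_path_uniq pq) (is_path_uniq pq') lt1 => /ltW le1.
apply: le_trans (le_trans le1 _); last by rewrite lerDl mulr_ge0 // ltW.
by rewrite lerD2l ler_wpM2l ?ler_nat ?eta_le_card ?(is_path_uniq pq) // ltW.
Qed.

(** Paths have bounded length, so a path of least penalized cost exists; by the gap it is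
    lexicographically minimal. *)
Lemma lex_min_exists s t H S q0 : S \subset H -> @is_path (residual S) s t q0 ->
  exists q, lex_min_path c s t H S q.
Proof.
move=> sH p0; have [eps hg] := gap_exists; have [e0 _] := hg.
pose B := (#|vertex G|).-bseq (edge G).
pose P (q : B) := @is_path (residual S) s t q.
pose w (q : B) := path_cost (residual_cost (penalized eps H) S) q.
have b0 : (size q0 <= #|vertex G|)%N := @size_is_path (residual S) s t q0 p0.
have P0 : P (Bseq b0) by [].
case: (arg_minP w P0) => q pq mq; exists q; split=> // q' pq'.
have := mq (Bseq (@size_is_path (residual S) s t q' pq' : (size q' <= #|vertex G|)%N)) pq'; rewrite /w !penalized_path_cost //= => le1.
have [lt1|gt1|eq1] := ltgtP (path_cost (residual_cost c S) q)
    (path_cost (residual_cost c S) q'); [by left| |].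
  have := gap_path hg (is_path_uniq pq') (is_path_uniq pq) gt1.
  have : eps * (eta H S q')%:R <= eps * #|edge G|%:R.
    by rewrite ler_wpM2l ?ler_nat ?eta_le_card ?(is_path_uniq pq') // ltW.
  have : 0 <= eps * (eta H S q)%:R by rewrite mulr_ge0 // ltW.
  by lra.
by right; split=> //; move: le1; rewrite eq1 lerD2l ler_pM2l // ler_nat.
Qed.

End Penalty.

(** * One round of the construction *)

Section Exchange.

Variables (R : realFieldType) (G : digraph) (c : edge G -> R).
Hypothesis hc : forall e, 0 <= c e.
Implicit Types (F S T C D H : {set edge G}).

Lemma excess_symdK S T v :
  @excess (residual S) (symd T S) v = excess T v - excess S v.
Proof. by have := excess_symd S (symd T S) v; rewrite symdK => ->; rewrite addrC addKr. Qed.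

Lemma excess_symd_sub S T C v : C \subset symd T S ->
  excess (symd T C) v = excess T v - @excess (residual S) C v.
Proof.
move=> sC; rewrite -(symd_setD sC) excess_symd (@excess_setD (residual S)) //.
by rewrite excess_symdK; ring.
Qed.

Lemma cost_symd_sub (d : edge G -> R) S T C : C \subset symd T S ->
  \sum_(e in symd T C) d e = \sum_(e in T) d e - \sum_(e in C) residual_cost d S e.
Proof.
move=> sC; rewrite -(symd_setD sC) cost_symd sum_setD //.
by have := cost_symd d S (symd T S); rewrite symdK => ->; ring.
Qed.

Lemma is_path_rcons_neq (G' : digraph) (x y : vertex G') q e :
  is_path x y (rcons q e) -> x != y.
Proof.
move=> pq; rewrite -(is_path_last pq) eq_sym.
by apply: is_path_target pq _; rewrite mem_rcons inE eqxx.
Qed.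

Lemma rcons_cycle S e q :
  e \notin S -> @is_path (residual S) (tgt e) (src e) q -> e \notin q ->
  @walk (residual S) (tgt e) (rcons q e) (tgt e) /\ uniq (rcons q e).
Proof.
move=> eS pq eq; rewrite rcons_uniq eq (is_path_uniq pq) -cats1; split=> //.
by apply: (walk_catI (is_path_walk pq)); rewrite /= (negPf eS) !eqxx.
Qed.

Variables (s : vertex G) (k : nat) (H : {set edge G}).

(* [St] and the initial part [P1] of the path to [t], which ends with the edge
   [e] outside [H], form an optimal flow.  Relative to [Sv] this flow reaches
   [e] from [s], since a cycle through [e] could be cancelled to reduce the
   penalized cost.  The path from [s] costs at most as much as [P1], and the
   rest [P2] of the path to [t] has positive penalized cost. *)
Lemma marginal_cost_lt (eps : R) t v St Sv Pt Pv e :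
  0 < eps -> s != t -> s != v -> v != t ->
  flow s t k St -> optimal c St -> St \subset H ->
  flow s v k Sv -> optimal c Sv -> Sv \subset H ->
  shortest (penalized c eps H) St s t Pt ->
  shortest (penalized c eps H) Sv s v Pv ->
  (exists f q, Pt = rcons q f /\ f \notin H) ->
  e \in Pt -> e \notin H -> tgt e = v ->
  path_cost (residual_cost (penalized c eps H) Sv) Pv <
  path_cost (residual_cost (penalized c eps H) St) Pt.
Proof.
move=> e0 st sv vt fSt oSt sSt fSv oSv sSv mPt [_ mPv] [f [q0 [Pt0 fH]]] ePt eH te.
set w := penalized c eps H in mPt mPv *.
have oSt' : optimal w St by apply: penalized_optimal => //; apply: ltW.
have eSt : e \notin St by apply: contra eH => /(subsetP sSt).
have eSv : e \notin Sv by apply: contra eH => /(subsetP sSv).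
have [pPt _] := mPt.
have [P1 [P2 PtE]] : exists P1 P2, Pt = rcons P1 e ++ P2.
  by case/splitPr: ePt => P1 P2; exists P1, P2; rewrite cat_rcons.
move: (pPt); rewrite PtE => /is_path_cat[z [p1 p2]].
have ? : z = v by rewrite -(is_path_last p1) /= (negPf eSt) te.
subst z.
(* The last edge [f] of [Pt] belongs to [P2], since [v] differs from [t], and it is penalized. *)
have P2pos : 0 < path_cost (residual_cost w St) P2.
  rewrite penalized_path_cost //.
  have : 0 <= path_cost (residual_cost c St) P2.
    exact: residual_to_sink_ge0 hc fSt oSt p2.
  suff : 0 < eps * (eta H St P2)%:R by lra.
  rewrite mulr_gt0 // ltr0n -has_count; apply/hasP; exists f; last first.
    by rewrite fH andbT; apply: contra fH => /(subsetP sSt).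
  move: PtE p2; rewrite Pt0; case/lastP: P2 => [|P2 f'].
    by move=> _ /is_path_walk /= /eqP vt'; rewrite vt' eqxx in vt.
  by rewrite -rcons_cat => /rcons_inj[_ <-] _; rewrite mem_rcons inE eqxx.
have m1 : shortest w St s v (rcons P1 e).
  by apply: shortest_prefix p1 p2 => //; rewrite -PtE.
rewrite path_cost_cat.
suff : path_cost (residual_cost w Sv) Pv <= path_cost (residual_cost w St) (rcons P1 e).
  by lra.
pose T := symd St [set:: rcons P1 e].
have oT : optimal w T by apply: shortest_optimal m1.
have exT x : excess T x = excess St x + ((v == x)%:Z - (s == x)%:Z).
  exact: excess_symd_path p1.
have eT : e \in T by rewrite in_symd (negPf eSt) inE mem_rcons inE eqxx.
have eD : e \in symd T Sv by rewrite in_symd eT (negPf eSv).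
have := @excess_trace_back (residual Sv) (symd T Sv) e eD.
rewrite /= (negPf eSv) => -[].
  (* The cycle has nonnegative cost and pays a penalty for [e], so cancelling it in [T] contradicts
     the optimality of [T]. *)
  case=> q [pq sq]; exfalso.
  have eq : e \notin q by apply/negP=> /sq; rewrite !inE eqxx.
  have [wC uC] := rcons_cycle eSv pq eq.
  have sC : [set:: rcons q e] \subset symd T Sv.
    apply: seq_subset => g; rewrite mem_rcons inE => /orP[/eqP -> //|/sq].
    by rewrite in_setD1 => /andP[].
  have /oT : excess (symd T [set:: rcons q e]) =1 excess T.
    by move=> x; rewrite (excess_symd_sub _ sC) (walk_excess _ wC) // subrr subr0.
  rewrite (cost_symd_sub _ sC) -path_costE // penalized_path_cost //.
  have := residual_cycle_ge0 oSv uC wC.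
  suff : 0 < eps * (eta H Sv (rcons q e))%:R by lra.
  rewrite mulr_gt0 // ltr0n -has_count; apply/hasP.
  by exists e; rewrite ?mem_rcons ?inE ?eqxx ?eSv.
case=> x [q [negx /= pq sq]]; rewrite te in pq.
have xv := is_path_rcons_neq pq.
(* Away from [s] and [v], the excess of [T] minus that of [Sv] is [k] at [t] and 0 elsewhere. *)
have ? : x = s.
  have [//|xs] := eqVneq x s; move: negx.
  rewrite excess_symdK exT fSt fSv ![_ == x]eq_sym (negPf xv) (negPf xs).
  by rewrite (_ : Posz false = 0) // !subr0 mulr0 subr0 ltNge mulr_ge0.
subst x; have uq := is_path_uniq pq; have sC := seq_subset sq.
apply: (le_trans (mPv _ pq)).
(* Cancelling the path to [v] in [T] restores the demands of [St], so the path costs at most what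
   [rcons P1 e] added. *)
have /oSt' : excess (symd T [set:: rcons q e]) =1 excess St.
  move=> x; rewrite (excess_symd_sub _ sC) (walk_excess _ (is_path_walk pq)) //.
  by rewrite exT addrK.
rewrite (cost_symd_sub _ sC) -path_costE // cost_symd -path_costE ?(is_path_uniq p1) //.
by lra.
Qed.

(** The [k] paths already use all [k] edges of [H] entering [t]. A last edge in [H] would thus lie
    in [S], whose edges never leave [t] and so cannot be traversed backwards into it. *)
Lemma last_edge_fresh t S (Q : 'I_k -> seq (edge G)) (P : seq (edge G)) :
  s != t -> disjoint_paths s t Q -> family_edges Q = S -> S \subset H ->
  indegree H t = k -> @is_path (residual S) s t P ->
  exists e q, [/\ P = rcons q e, e \notin S, e \notin H & tgt e = t].
Proof.
move=> st dQ QS sH kH pP; case/lastP: P pP => [|q e] pP.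
  by case/is_path_walk/eqP: pP => h; rewrite h eqxx in st.
exists e, q; have := is_path_last pP; rewrite /=; case: ifP => [|/negbT] eS te.
  by have := @family_source G s t k Q e dQ; rewrite QS te eqxx => /(_ eS).
split=> //; apply: contra eS => eH.
have inS : [set f in S | tgt f == t] = [set f in H | tgt f == t].
  apply/eqP; rewrite eqEcard; apply/andP; split.
    by apply/subsetP=> f; rewrite !inE => /andP[/(subsetP sH) -> ->].
  by rewrite -!/(indegree _ _) kH -QS (indegree_family st dQ).
have : e \in [set f in H | tgt f == t] by rewrite inE eH te eqxx.
by rewrite -inS inE => /andP[].
Qed.

Lemma last_edgesP (P : vertex G -> seq (edge G)) e :
  reflect (exists2 t, t != s & exists q, P t = rcons q e) (e \in last_edges s P).
Proof.
rewrite inE; apply: (iffP existsP) => [[t /andP[ts /eqP]]|[t ts [q Pq]]].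
  move Pq: (P t) => p; case/lastP: p Pq => [//|q f] Pq; rewrite rev_rcons => -[<-].
  by exists t => //; exists q.
by exists t; rewrite ts Pq rev_rcons /= eqxx.
Qed.

Lemma min_cost_edge_set_optimal t S : s != t -> min_cost_edge_set c s t k H S ->
  [/\ flow s t k S, optimal c S, S \subset H & indegree S t = k].
Proof.
move=> st [Q [mQ <- sQ]]; split=> //; first exact: disjoint_paths_flow mQ.1.
  exact: min_cost_optimal mQ.
exact: indegree_family mQ.1.
Qed.

Variables (S : vertex G -> {set edge G}) (P : vertex G -> seq (edge G)).
Hypothesis hS : forall t, t != s -> min_cost_edge_set c s t k H (S t).
Hypothesis hP : forall t, t != s -> lex_min_path c s t H (S t) (P t).
Hypothesis hH : forall t, t != s -> indegree H t = k.

Let H1 := H :|: last_edges s P.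

Lemma round_last_edge t : t != s ->
  exists e q, [/\ P t = rcons q e, e \notin S t, e \notin H & tgt e = t].
Proof.
move=> ts; have [Q [mQ QS sQ]] := hS ts; have [pP _] := hP ts.
by apply: (last_edge_fresh _ mQ.1 QS sQ (hH ts) pP); rewrite eq_sym.
Qed.

(** Two inductions are nested. The outer one counts the vertices with smaller [d], since the order
    on costs is not well-founded; the inner one counts the edges of the current flow outside
    [H1]. *)
Lemma round_optimal_flow t : t != s ->
  exists F, [/\ flow s t k.+1 F, optimal c F & F \subset H1].
Proof.
have [eps hg] := gap_exists c; have [e0 _] := hg.
pose d t := path_cost (residual_cost (penalized c eps H) (S t)) (P t).
have [n] := ubnP #|[set v | d v < d t]|; elim: n t => // n IHn t le_n ts.
have st : s != t by rewrite eq_sym.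
have [fS oS sS iS] := min_cost_edge_set_optimal st (hS ts).
have [mP mPw] := lex_min_shortest hg sS (hP ts); have [pP _] := mP.
have [f [q0 [Pt0 fS' fH tf]]] := round_last_edge ts.
(* The last clause lets the outer induction apply to the head of any edge still outside [H1]. *)
pose good F := [/\ flow s t k.+1 F, optimal c F & forall e, e \in F -> e \notin H1 ->
  [/\ tgt e != s, tgt e != t & d (tgt e) < d t]].
have good0 : good (symd (S t) [set:: P t]).
  split; last 1 first.
  - move=> e; rewrite in_symd in_setU negb_or inE => + /andP[eH eL].
    have eS : e \notin S t by apply: contra eH => /(subsetP sS).
    rewrite (negPf eS) /= => eP.
    have es : tgt e != s by have := is_path_target pP eP; rewrite /= (negPf eS).
    (* The only edge by which the path enters [t] is its last one, which [H1] contains. *)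
    have et : tgt e != t.
      apply: contra eL => /eqP te; apply/last_edgesP; exists t => //; exists q0.
      rewrite Pt0 in eP pP *; congr (rcons _ _); apply/esym.
      by apply: (is_path_tgt_end pP eP); rewrite /= (negPf eS).
    split=> //; have sv : s != tgt e by rewrite eq_sym.
    have [fSv oSv sSv _] := min_cost_edge_set_optimal sv (hS es).
    have [_ mPv] := lex_min_shortest hg sSv (hP es).
    apply: (marginal_cost_lt e0 st sv et fS oS sS fSv oSv sSv mPw mPv _ eP eH) => //.
    by exists f, q0.
  - move=> v; rewrite (excess_symd_path _ pP) fS intS; ring.
  - exact: shortest_optimal mP.
have [m] := ubnP #|symd (S t) [set:: P t] :\: H1|.
move: good0; move: (symd _ _) => F; elim: m F => // m IHm F gF le_m.
have [fF oF bF] := gF; have [|] := boolP (F :\: H1 == set0).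
  by rewrite setD_eq0 => sF; exists F.
case/set0Pn=> e; rewrite inE => /andP[eH1 eF]; have [vs vt dv] := bF e eF eH1.
case: (IHn (tgt e)) => // [|T [fT oT sT]].
  rewrite ltnS in le_n; apply: leq_trans le_n; apply: proper_card; apply/properP; split.
    by apply/subsetP=> u; rewrite !inE => /lt_trans; apply.
  by exists (tgt e); rewrite inE ?ltxx.
have eT : e \notin T by apply: contra eH1 => /(subsetP sT).
have eD : e \in symd F T by rewrite in_symd eF (negPf eT).
have := @excess_trace_back (residual T) (symd F T) e eD.
(* [F] and [T] have equal values and the common source [s], so their difference is negative only at
   [tgt e], and only the cycle case remains. *)
rewrite /= (negPf eT) => -[]; last first.
  case=> x [q [negx pq _]]; have xv := is_path_rcons_neq pq.
  move: negx; rewrite excess_symdK fF fT [tgt e == x]eq_sym (negPf xv).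
  by rewrite -mulrBr ltNge mulr_ge0 //; case: (t == x); case: (s == x).
case=> q [pq sq]; have eq : e \notin q by apply/negP=> /sq; rewrite !inE eqxx.
have [wC uC] := rcons_cycle eT pq eq.
have sC : [set:: rcons q e] \subset symd F T.
  apply: seq_subset => g; rewrite mem_rcons inE => /orP[/eqP -> //|/sq].
  by rewrite in_setD1 => /andP[].
pose F' := symd F [set:: rcons q e].
have exF' : excess F' =1 excess F.
  by move=> x; rewrite (excess_symd_sub _ sC) (walk_excess _ wC) // subrr subr0.
(* Since [T] lies in [H1], the edges of the cycle outside [H1] belong to [F]: they are deleted, [e]
   among them, and none is added. *)
have sF' : F' :\: H1 \subset (F :\: H1) :\ e.
  apply/subsetP=> g; rewrite !in_setD in_set1 in_symd => /andP[gH1 gF'].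
  have gT : g \notin T by apply: contra gH1 => /(subsetP sT).
  have := subsetP sC g; rewrite in_symd (negPf gT) addbF.
  move: gF'; have [-> | ge] := eqVneq g e.
    by rewrite eF inE mem_rcons inE eqxx.
  by rewrite gH1; case: (g \in F) => //= -> /(_ isT).
apply: (IHm F'); last first.
  rewrite ltnS (cardsD1 e) inE eH1 eF in le_m; apply: leq_trans le_m.
  by rewrite ltnS subset_leq_card.
split.
- by move=> x; rewrite exF'.
- move=> F2 exF2; have /oF : excess F2 =1 excess F by move=> x; rewrite exF2.
  apply: le_trans; rewrite (cost_symd_sub _ sC) -path_costE //.
  by rewrite lerBlDr lerDl (residual_cycle_ge0 oT uC wC).
- move=> g gF' gH1; apply: (bF g _ (gH1)); have : g \in F' :\: H1 by rewrite inE gH1.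
  by move/(subsetP sF'); rewrite !inE => /andP[_ /andP[]].
Qed.

(** Each chosen path contributes an edge into its own endpoint only, so [t] gains just the last edge
    of [P t]. *)
Lemma round_in_edges t e q : t != s -> P t = rcons q e ->
  [set f in H1 | tgt f == t] = e |: [set f in H | tgt f == t].
Proof.
move=> ts Pe; apply/setP=> f; rewrite in_set /H1 !in_setU in_set1 [in RHS]in_set.
have [e' [q' [Pe' _ _ te]]] := round_last_edge ts.
move: Pe'; rewrite Pe => /rcons_inj[_ ?]; subst e'.
have [->|fe] := eqVneq f e.
  by rewrite te eqxx andbT; apply/orP; right; apply/last_edgesP; exists t => //; exists q.
rewrite /=; case: eqP => [tf|_]; rewrite ?andbF // !andbT.
have [//|/=] := boolP (f \in H); case: last_edgesP => // -[u us [q2 Pf]] _.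
have [g [q3 [Pg _ _ tg]]] := round_last_edge us.
move: Pg; rewrite Pf => /rcons_inj[_ ?]; subst g.
move: Pf; rewrite -tg tf Pe => /rcons_inj[_ ef].
by rewrite ef eqxx in fe.
Qed.

Lemma round_indegree t : t != s -> indegree H1 t = k.+1.
Proof.
move=> ts; have [e [q [Pe _ eH _]]] := round_last_edge ts.
by rewrite /indegree (round_in_edges ts Pe) cardsU1 inE (negPf eH) -(hH ts).
Qed.

Lemma round_indegree_source : indegree H1 s = indegree H s.
Proof.
congr #|pred_of_set _|; apply/setP=> f; rewrite in_set [in RHS]in_set /H1 in_setU.
have [//|/=] := boolP (f \in H); case: last_edgesP => // -[u us [q Pf]] _.
have [g [q3 [Pg _ _ tg]]] := round_last_edge us.
move: Pg; rewrite Pf => /rcons_inj[_ ?]; subst g.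
by rewrite tg (negPf us).
Qed.

End Exchange.

(** * Invariants of a run *)

Section Run.

Variables (R : realFieldType) (G : digraph) (c : edge G -> R) (s : vertex G).
Hypothesis hc : forall e, 0 <= c e.

Variables (k : nat) (H : nat -> {set edge G}).
Variables (S : nat -> vertex G -> {set edge G}) (P : nat -> vertex G -> seq (edge G)).
Hypothesis hrun : run c s k H S P.

Lemma run_indegree i t : (i <= k)%N -> t != s -> indegree (H i) t = i.
Proof.
have [H0 hstep] := hrun; elim: i t => [|i IH] t ik ts.
  by rewrite /indegree H0; apply: eq_card0 => e; rewrite !inE.
have [hS hP ->] := hstep _ ik.
by apply: (round_indegree hS hP) ts => u; apply: IH; apply: ltnW.
Qed.

Lemma run_indegree_source i : (i <= k)%N -> indegree (H i) s = 0%N.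
Proof.
have [H0 hstep] := hrun; elim: i => [|i IH] ik.
  by rewrite /indegree H0; apply: eq_card0 => e; rewrite !inE.
have [hS hP ->] := hstep _ ik; have hH u (us : u != s) := run_indegree (ltnW ik) us.
by rewrite (round_indegree_source hS hP hH) IH // ltnW.
Qed.

Lemma run_min_cost_edge_set i t : (i <= k)%N -> t != s ->
  exists F, min_cost_edge_set c s t i (H i) F.
Proof.
have [H0 hstep] := hrun; have st : t != s -> s != t by rewrite eq_sym.
move=> ik ts; suff [F [fF oF sF]] : exists F, [/\ flow s t i F, optimal c F & F \subset H i].
  have [Q [mQ sQ]] := optimal_min_cost hc (st ts) fF oF.
  by exists (family_edges Q), Q; split=> //; apply: subset_trans sQ sF.
case: i ik => [|i] ik; last first.
  have [hS hP ->] := hstep _ ik; have hH u (us : u != s) := run_indegree (ltnW ik) us.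
  exact: round_optimal_flow hS hP hH _ ts.
exists set0; split; last by rewrite sub0set.
  by move=> v; rewrite /excess big_set0 mul0r.
by move=> F _; rewrite big_set0 sumr_ge0.
Qed.

Lemma run_subset i j : (i <= j)%N -> (j <= k)%N -> H i \subset H j.
Proof.
move=> /subnKC <-; elim: (j - i)%N => [|m IH]; first by rewrite addn0.
rewrite addnS => mk; have [_ _ ->] := hrun.2 _ mk.
by apply: subset_trans (IH (ltnW mk)) (subsetUl _ _).
Qed.

Lemma run_in_edges i t e q : (i < k)%N -> t != s -> P i t = rcons q e ->
  [set f in H i.+1 | tgt f == t] = e |: [set f in H i | tgt f == t].
Proof.
move=> ik ts Pe; have [hS hP ->] := hrun.2 _ ik.
have hH u (us : u != s) := run_indegree (ltnW ik) us.
exact: round_in_edges hS hP hH _ _ _ ts Pe.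
Qed.

Lemma run_last_edge i t : (i < k)%N -> t != s ->
  exists e q, [/\ P i t = rcons q e, e \notin S i t, e \notin H i & tgt e = t].
Proof.
move=> ik ts; have [hS hP _] := hrun.2 _ ik.
have hH u (us : u != s) := run_indegree (ltnW ik) us.
exact: round_last_edge hS hP hH _ ts.
Qed.

End Run.

(** The difference between [p] disjoint paths and the current [k] of them is a residual flow of
    value [p - k], positive before the last round, which contains a path from [s] to [t]. *)
Lemma outconnected_never_stuck (R : realFieldType) (G : digraph) (c : edge G -> R)
    (s : vertex G) (p : nat) :
  (forall e, 0 <= c e) ->
  (forall t, t != s -> exists Q : 'I_p -> seq (edge G), disjoint_paths s t Q) ->
  never_stuck c s p.
Proof.
move=> hc hQ k H S P kp hrun t ts; split; first exact: (run_min_cost_edge_set hc hrun).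
move=> ltkp F hF; have st : s != t by rewrite eq_sym.
have [fF _ sF _] := min_cost_edge_set_optimal hc st hF; have [Q dQ] := hQ t ts.
have exD v : @excess (residual F) (symd (family_edges Q) F) v =
    (p%:Z - k%:Z) * ((t == v)%:Z - (s == v)%:Z).
  by rewrite excess_symdK fF (disjoint_paths_flow dQ) mulrBl.
have pk : 0 < p%:Z - k%:Z by rewrite subr_gt0.
have [|y [q [py pq _]]] := @excess_trace (residual F) (symd (family_edges Q) F) s.
  by rewrite exD eqxx eq_sym (negPf st) sub0r mulrN mulr1 oppr_lt0.
apply: (@lex_min_exists _ _ c s t _ _ q sF).
suff <- : y = t by [].
apply/eqP; apply: contraTT py => yt; rewrite exD [t == y]eq_sym (negPf yt).
by rewrite -leNgt sub0r mulrN oppr_le0 mulr_ge0 // ltW.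
Qed.

(** * The augmented digraph *)

Lemma sum_setU_disjoint (V : zmodType) (T : finType) (A B : {set T}) (g : T -> V) :
  [disjoint A & B] ->
  \sum_(e in A :|: B) g e = \sum_(e in A) g e + \sum_(e in B) g e.
Proof.
move=> dAB; rewrite (big_setID A) /= setUK setDUl setDv set0U.
by rewrite (setDidPl _) // disjoint_sym.
Qed.

Lemma card_sumr (R : pzRingType) (T : finType) (A : {set T}) (a : pred T) :
  #|[set e in A | a e]|%:R = \sum_(e in A) (a e)%:R :> R.
Proof.
rewrite -sum1_card natr_sum big_mkcond [RHS]big_mkcond; apply: eq_bigr => e _.
by rewrite inE; case: (e \in A); case: (a e).
Qed.

Lemma optimal_exists (R : realFieldType) (G : digraph) (c : edge G -> R)
    (F0 : {set edge G}) : exists2 F, excess F =1 excess F0 & optimal c F.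
Proof.
pose B := {set edge G}.
pose Q (F : B) := [forall v, excess F v == excess F0 v].
have Q0 : Q F0 by apply/forallP=> v.
case: (arg_minP (fun F : B => \sum_(e in F) c e) Q0) => F /forallP QF mF.
have exF : excess F =1 excess F0 by move=> v; apply/eqP.
exists F => // F' exF'; apply: mF; apply/forallP=> v.
by rewrite exF' exF.
Qed.

Section Augment.

Variables (R : realFieldType) (G : digraph) (s : vertex G) (c : edge G -> R).
Variables (p : nat) (M : R).
Hypothesis hc : forall e, 0 <= c e.
Hypothesis hM : \sum_(e : edge G) c e < M.

Notation G' := (augment s p).
Notation old := (@old_edge G s p).
Notation s' := (old_vertex s p s).
Notation c' := (@aug_cost R G s p c M).
Implicit Types (F S : {set edge G'}) (e : edge G') (q : seq (edge G')).

Definition is_old e : bool := if e is inl (inl (inl _)) then true else false.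
Definition from_source e : bool := if e is inl (inr _) then true else false.
Definition into_old e : bool := if e is inr _ then true else false.
Definition between_dummies e : bool := if e is inl (inl (inr _)) then true else false.
Definition is_dummy_vertex (v : vertex G') : bool := if v is inr _ then true else false.

Definition num_of (a : pred (edge G')) F : nat := #|[set e in F | a e]|.
Definition old_part F : {set edge G'} := [set e in F | is_old e].
Definition from_to j t (ts : t != s) : seq (edge G') :=
  [:: inl (inr j); inr (j, exist _ t ts)].

Lemma M_gt0 : 0 < M.
Proof. by apply: le_lt_trans hM; apply: sumr_ge0. Qed.

Lemma aug_cost_ge0 e : 0 <= c' e.
Proof. by case: e => [[[e|e]|e]|e] //=; apply: ltW M_gt0. Qed.

Lemma old_inj : injective old.
Proof. by move=> e f []. Qed.

Lemma is_oldP e : reflect (exists e0 : edge G, e = old e0) (is_old e).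
Proof.
apply: (iffP idP) => [|[e0 ->] //].
by case: e => [[[e0|]|]|] // _; exists e0.
Qed.

Lemma walk_old x (q0 : seq (edge G)) y :
  walk (old_vertex s p x) (map old q0) (old_vertex s p y) = walk x q0 y.
Proof. by elim: q0 x => [|e q0 IH] x //=; rewrite -IH. Qed.

Lemma is_path_old x (q0 : seq (edge G)) y :
  is_path (old_vertex s p x) (old_vertex s p y) (map old q0) = is_path x y q0.
Proof.
rewrite /is_path walk_old; congr (_ && _).
rewrite -[RHS](map_inj_uniq (f := old_vertex s p)) => [|a b []//].
by rewrite /= -!map_comp.
Qed.

Lemma disjoint_old (q1 q2 : seq (edge G)) :
  [disjoint map old q1 & map old q2] = [disjoint q1 & q2].
Proof.
rewrite !disjoint_subset; apply/subsetP/subsetP => h e.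
  by move=> e1; have := h (old e); rewrite !inE !(mem_map old_inj); apply.
by case/mapP=> e0 e1 ->; have := h e0 e1; rewrite !inE (mem_map old_inj).
Qed.

Lemma disjoint_paths_old (t : vertex G) k (Q : 'I_k -> seq (edge G)) :
  disjoint_paths s' (old_vertex s p t) (fun i => map old (Q i)) <->
  disjoint_paths s t Q.
Proof.
by split=> -[pQ dQ]; split=> [i|i j /dQ]; rewrite ?disjoint_old //;
  have := pQ i; rewrite is_path_old.
Qed.

Lemma map_old_lift q : all is_old q -> exists q0 : seq (edge G), q = map old q0.
Proof.
elim: q => [|e q IH]; first by exists [::].
by case/andP=> /is_oldP[e0 ->] /IH[q0 ->]; exists (e0 :: q0).
Qed.

Lemma old_family_lift (t : vertex G) k (Q : 'I_k -> seq (edge G')) :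
  disjoint_paths s' (old_vertex s p t) Q ->
  (forall e, e \in family_edges Q -> is_old e) ->
  exists Q0 : 'I_k -> seq (edge G), disjoint_paths s t Q0.
Proof.
move=> dQ oQ.
have /fin_all_exists[Q0 QE] : forall i, exists q0 : seq (edge G), Q i = map old q0.
  move=> i; apply: map_old_lift; apply/allP=> e eQ; apply: oQ.
  by apply/bigcupP; exists i; rewrite ?inE.
exists Q0; apply/disjoint_paths_old; case: dQ => pQ dQ.
by split=> [i|i j]; rewrite -!QE; [apply: pQ | apply: dQ].
Qed.

Lemma from_to_disjoint (t : vertex G) (ts : t != s) r (rp : (r <= p)%N) :
  disjoint_paths s' (old_vertex s p t)
    (fun j : 'I_r => from_to (widen_ord rp j) ts).
Proof.
split=> [i|i j ij].
  rewrite /is_path /= !eqxx /= !inE /= andbT.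
  by rewrite eq_sym.
rewrite disjoint_subset; apply/subsetP=> e; rewrite !inE.
have ij' : widen_ord rp i != widen_ord rp j by [].
case/orP=> /eqP ->; rewrite negb_or; apply/andP; split=> //; apply: contra ij'.
by move=> /eqP[h]; apply/eqP/val_inj.
Qed.

Lemma to_dummy_disjoint (j : 'I_p) : exists Q : 'I_p -> seq (edge G'),
  disjoint_paths s' (inr j : vertex G') Q.
Proof.
(* [insub] fails exactly for [k = j], where the direct edge from [s] replaces the detour through
   another dummy. *)
pose Q (k : 'I_p) : seq (edge G') :=
  if insub (k, j) is Some kj then [:: inl (inr k); inl (inl (inr kj))]
  else [:: inl (inr j)].
have QE k : (k = j /\ Q k = [:: inl (inr j)]) \/
    exists kj, [/\ (val kj).1 = k, (val kj).2 = j & Q k = [:: inl (inr k); inl (inl (inr kj))]].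
  rewrite /Q; case: insubP => [kj _ vk|] /=; first by right; exists kj; rewrite vk.
  by rewrite negbK => /eqP ->; left.
have src1 k e : e \in Q k -> e = inl (inr k) \/
    exists kj, (val kj).1 = k /\ e = inl (inl (inr kj)).
  case: (QE k) => [[-> ->]|[kj [<- _ ->]]]; rewrite !inE; first by move/eqP; left.
  by case/orP=> /eqP ->; [left | right; exists kj].
exists Q; split=> [k|k l kl].
  case: (QE k) => [[-> ->]|[kj [k1 k2 ->]]]; rewrite /is_path /= ?k1 ?k2 ?eqxx //=.
  rewrite !inE /= andbT; apply/negP=> /eqP[] kj'.
  by have := valP kj; rewrite k1 k2 kj' eqxx.
rewrite disjoint_subset; apply/subsetP=> e /src1 ek; rewrite inE.
apply/negP=> /src1 el; case/eqP: kl.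
case: ek el => [->|[kj [k1 ->]]] [|[lj [l1]]] //; first by case.
by case=> E; rewrite -k1 -l1 E.
Qed.

Lemma aug_connected (t : vertex G') : t != s' ->
  exists Q : 'I_p -> seq (edge G'), disjoint_paths s' t Q.
Proof.
case: t => [t|j] ts; last exact: to_dummy_disjoint.
have ts' : t != s by [].
by eexists; apply: (from_to_disjoint ts' (leqnn p)).
Qed.

Lemma old_cost_lt F : (forall e, e \in F -> is_old e) -> \sum_(e in F) c' e < M.
Proof.
move=> oF; apply: le_lt_trans hM.
have -> : \sum_(e : edge G) c e = \sum_(e in [set old e0 | e0 in [set: edge G]]) c' e.
  rewrite big_imset /= => [|e f _ _ /old_inj //].
  by apply: eq_bigl => e; rewrite inE.
apply: sum_subset => [e|]; first exact: aug_cost_ge0.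
by apply/subsetP=> e /oF/is_oldP[e0 ->]; apply: imset_f.
Qed.

Lemma aug_costE e : c' e =
  (if is_old e then c' e else 0) +
    M * ((from_source e)%:R + (into_old e)%:R + (between_dummies e)%:R).
Proof. by case: e => [[[e|e]|e]|e] /=; rewrite ?addr0 ?add0r ?mulr0 ?mulr1 ?addr0. Qed.

Lemma cost_split F : \sum_(e in F) c' e = \sum_(e in old_part F) c' e +
  M * ((num_of from_source F)%:R + (num_of into_old F)%:R
       + (num_of between_dummies F)%:R).
Proof.
rewrite (eq_bigr _ (fun e _ => aug_costE e)) big_split /= -mulr_sumr !big_split /=.
rewrite -!card_sumr; congr (_ + _); rewrite -big_mkcondr.
by apply: eq_bigl => e; rewrite inE.
Qed.

(** The total excess over the dummies is zero, and edges between dummies cancel in it. *)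
Lemma num_balance (t : vertex G) F k : flow s' (old_vertex s p t) k F ->
  num_of from_source F = num_of into_old F.
Proof.
move=> fF; pose A : {set vertex G'} := [set v | is_dummy_vertex v].
have : \sum_(v in A) excess F v = 0.
  rewrite big1 // => -[x|j]; rewrite inE // => _.
  by rewrite fF /= subrr mulr0.
rewrite sum_excess.
rewrite (eq_bigr (fun e => (from_source e)%:R - (into_old e)%:R)).
  by rewrite sumrB -!card_sumr => /eqP; rewrite subr_eq0 eqr_nat => /eqP.
by case=> [[[e|e]|e]|[j x]] _; rewrite !inE /= ?subrr.
Qed.

Lemma excess_old_part F v : excess (old_part F) v =
  excess F v - \sum_(e in F | ~~ is_old e) boundary e v.
Proof.
rewrite [excess F v](bigID is_old) /= addrK.
by apply: eq_bigl => e; rewrite inE.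
Qed.

Lemma excess_old_part_source F :
  excess (old_part F) s' = excess F s' + (num_of from_source F)%:Z.
Proof.
rewrite excess_old_part; congr (_ + _).
rewrite -natz card_sumr -sumrN big_mkcondr; apply: eq_bigr.
case=> [[[e|e]|e]|[j x]] _ //=; rewrite /boundary /=.
- by rewrite eqxx.
- have /negPf xs : old_vertex s p (val x) != s' := valP x.
  by rewrite xs.
Qed.

Lemma excess_old_part_other F (x : vertex G) : x != s ->
  excess (old_part F) (old_vertex s p x) = excess F (old_vertex s p x)
    - (num_of (fun e => into_old e && (tgt e == old_vertex s p x)) F)%:Z.
Proof.
move=> xs; rewrite excess_old_part; congr (_ - _).
rewrite -natz card_sumr big_mkcondr; apply: eq_bigr.
case=> [[[e|e]|e]|[j y]] _ //=; rewrite /boundary /=.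
- have /negPf sx : s' != old_vertex s p x by rewrite eq_sym.
  by rewrite sx.
- by rewrite subr0; case: eqP.
Qed.

Lemma excess_old_part_dummy F (j : 'I_p) : excess (old_part F) (inr j) = 0.
Proof.
by apply: big1 => e; rewrite inE => /andP[_ /is_oldP[e0 ->]].
Qed.

Variables (t : vertex G) (l : nat).
Hypothesis ts : t != s.
Hypothesis hl : max_disjoint_paths s t l.

Notation t' := (old_vertex s p t).

Lemma st' : s' != t'.
Proof. by rewrite eq_sym. Qed.

(** Dropping the edges at dummies costs [s] one unit per edge [(s,v_j)] and leaves deficits at old
    vertices other than [s], never a surplus outside [t]. *)
Lemma old_part_paths k m F : flow s' t' k F -> (m + num_of from_source F = k)%N ->
  exists Q : 'I_m -> seq (edge G'),
    disjoint_paths s' t' Q /\ family_edges Q \subset old_part F.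
Proof.
move=> fF mk; apply: flow_paths st' _ _ => [[x|j]|].
- have [-> //|xt] := eqVneq x t; have [->|xs] := eqVneq x s.
    by rewrite excess_old_part_source fF -mk eqxx eq_sym (negPf st') /=; lia.
  have /negPf xt' : t' != old_vertex s p x by rewrite eq_sym.
  have /negPf xs' : s' != old_vertex s p x by rewrite eq_sym.
  rewrite (excess_old_part_other _ xs) fF xt' xs' subrr mulr0 sub0r.
  by rewrite oppr_gt0 ltNge.
- by rewrite excess_old_part_dummy ltxx.
- by rewrite excess_old_part_source fF -mk eqxx eq_sym (negPf st') /=; lia.
Qed.

Lemma num_from_source_ge k F : flow s' t' k F -> (k - num_of from_source F <= l)%N.
Proof.
move=> fF; have [|lt_ak] := leqP k (num_of from_source F).
  by rewrite -subn_eq0 => /eqP ->.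
have [Q [dQ sQ]] := old_part_paths fF (subnK (ltnW lt_ak)).
have [e eQ|Q0 dQ0] := old_family_lift dQ; last exact: hl.2 _ _ dQ0.
by have := subsetP sQ e eQ; rewrite inE => /andP[].
Qed.

(** [k] of the [l] disjoint paths of [G] cost less than [M] together, while a single new edge
    already costs [M]. *)
Lemma optimal_low k F : (k <= l)%N -> flow s' t' k F -> optimal c' F ->
  \sum_(e in F) c' e < M /\ forall e, e \in F -> is_old e.
Proof.
move=> kl fF oF; have [[Q0 [pQ0 dQ0]] _] := hl.
pose Q (i : 'I_k) := map old (Q0 (widen_ord kl i)).
have dQ : disjoint_paths s' t' Q.
  apply/(disjoint_paths_old t (fun i => Q0 (widen_ord kl i))).
  by split=> [i|i j ij]; [apply: pQ0 | apply: dQ0].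
have costF : \sum_(e in F) c' e < M.
  apply: (le_lt_trans (y := \sum_(e in family_edges Q) c' e)).
    by apply: oF => v; rewrite fF (disjoint_paths_flow dQ).
  apply: old_cost_lt => e /bigcupP[i _]; rewrite inE => /mapP[e0 _ ->] //.
split=> // e eF; apply: contraTT costF => oe; rewrite -leNgt.
have cM : c' e = M by case: e oe {eF} => [[[e|e]|e]|e].
rewrite -[leLHS]cM -(big_set1 +%R e c'); apply: sum_subset; first exact: aug_cost_ge0.
by rewrite sub1set.
Qed.

Lemma optimal_flow_exists : exists2 F, flow s' t' l F & optimal c' F.
Proof.
have [[Q0 /disjoint_paths_old dQ] _] := hl.
have [F exF oF] := optimal_exists c' (family_edges (fun i => map old (Q0 i))).
by exists F => // v; rewrite exF (disjoint_paths_flow dQ).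
Qed.

(** The competitor is [FL] with [k - l] detours [s,v_j,t] through distinct dummies. They avoid [FL],
    which has only old edges. *)
Lemma optimal_high_le k F FL : (l <= k <= p)%N ->
  flow s' t' l FL -> optimal c' FL -> optimal c' F -> flow s' t' k F ->
  \sum_(e in F) c' e <= \sum_(e in FL) c' e + M * ((k - l).*2)%:R.
Proof.
move=> /andP[lk kp] fL oL oF fF; have [_ oldL] := optimal_low (leqnn l) fL oL.
have rp : (k - l <= p)%N by apply: leq_trans (leq_subr _ _) kp.
have dQ := from_to_disjoint ts rp.
set Q := (fun _ => _) in dQ.
have dL : [disjoint FL & family_edges Q].
  rewrite disjoint_subset; apply/subsetP=> e /oldL oe; rewrite inE.
  apply/negP=> /bigcupP[i _]; rewrite !inE => /orP[] /eqP ee.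
    by rewrite ee in oe.
  by rewrite ee in oe.
have /oF : excess (FL :|: family_edges Q) =1 excess F.
  move=> v; rewrite /excess sum_setU_disjoint // -!/(excess _ _).
  by rewrite fL fF (disjoint_paths_flow dQ) -mulrDl -PoszD subnKC.
rewrite sum_setU_disjoint // -(family_costE c' dQ).
move/le_trans; apply; rewrite lerD2l /family_cost.
rewrite (eq_bigr (fun=> M * 2)) => [|i _]; last first.
  by rewrite /path_cost !big_cons big_nil /=; ring.
by rewrite sumr_const card_ord -mulrnAr -mulrnA mul2n.
Qed.

(* An optimal flow of value [k >= l] consists of [l] paths of the original
   digraph and [k - l] detours, each using exactly two edges of cost [M]. *)
Lemma optimal_high k F FL : (l <= k <= p)%N ->
  flow s' t' l FL -> optimal c' FL -> optimal c' F -> flow s' t' k F ->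
  [/\ num_of from_source F = (k - l)%N, num_of into_old F = (k - l)%N,
      num_of between_dummies F = 0%N,
      \sum_(e in F) c' e = \sum_(e in FL) c' e + M * ((k - l).*2)%:R
    & (forall e0 : edge G, 0 < c e0) -> forall e, e \in F -> into_old e -> tgt e = t'].
Proof.
move=> lkp fL oL oF fF; have := optimal_high_le lkp fL oL oF fF.
have [lk kp] := andP lkp; have [costL _] := optimal_low (leqnn l) fL oL.
have ab := num_balance fF; have := num_from_source_ge fF.
rewrite cost_split -ab; set a := num_of _ F; set b := num_of _ F => ka le1.
have cost0 : 0 <= \sum_(e in old_part F) c' e.
  by apply: sumr_ge0 => e _; apply: aug_cost_ge0.
(* As [FL] costs less than [M], the number [2a + b] of new edges is at most [2(k - l)]; together
   with [a >= k - l] this fixes [a] and [b]. *)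
have : M * (a.*2 + b)%:R < M * ((k - l).*2.+1)%:R.
  rewrite -addn1 -[a.*2]addnn !natrD !mulrDr mulr1.
  by move: le1; rewrite !mulrDr; lra.
rewrite ltr_pM2l ?M_gt0 // ltr_nat ltnS => le2.
have ra : a = (k - l)%N by move: ka le2 lk; rewrite -!addnn; lia.
have b0 : b = 0%N by move: le2; rewrite ra -!addnn; lia.
have [Q [dQ sQ]] : exists Q : 'I_l -> seq (edge G'),
    disjoint_paths s' t' Q /\ family_edges Q \subset old_part F.
  by apply: old_part_paths fF _; rewrite -/a ra subnKC.
have costQ : \sum_(e in FL) c' e <= \sum_(e in family_edges Q) c' e.
  by apply: oL => v; rewrite fL (disjoint_paths_flow dQ).
have leQ := sum_subset aug_cost_ge0 sQ.
have MN : M * (a%:R + a%:R + b%:R) = M * (k - l).*2%:R.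
  by rewrite b0 addr0 ra -natrD addnn.
rewrite -/a -/b in le1 *.
split=> //; first by rewrite MN; move: le1; rewrite MN; lra.
move=> posc e eF ie.
(* An old edge outside the [l] paths would have positive cost and break the cost bound. A new edge
   into some [x] other than [t] would then leave a deficit at [x], which the paths do not have. *)
have QE : family_edges Q = old_part F.
  apply/eqP; rewrite eqEsubset sQ; apply/subsetP=> f fo; apply/negPn/negP=> fQ.
  have := sum_subset (c := c') (F := [set f]) (F' := old_part F :\: family_edges Q)
    aug_cost_ge0.
  rewrite sub1set inE fQ fo => /(_ isT); rewrite big_set1 sum_setD //.
  have : 0 < c' f.
    by move: fo; rewrite inE => /andP[_ /is_oldP[f0 ->]]; apply: posc.
  by move: le1; rewrite MN; lra.
case: e eF ie => [//|[j [x xs]]] eF _; rewrite /=; congr (inl _); apply/eqP.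
apply: contraT => xt.
have := excess_old_part_other F xs; rewrite -QE (disjoint_paths_flow dQ) fF.
have /negPf xt' : t' != old_vertex s p x by rewrite eq_sym.
have /negPf xs' : s' != old_vertex s p x by rewrite eq_sym.
rewrite xt' xs' subrr !mulr0 sub0r => /esym/eqP; rewrite oppr_eq0.
rewrite /num_of => /eqP[] /eqP; rewrite cards_eq0 => /eqP/setP/(_ (inr (j, exist _ x xs))).
by rewrite !inE eF /= eqxx.
Qed.

Lemma num_of_lt (a : pred (edge G')) F S : (num_of a S < num_of a F)%N ->
  exists e, [/\ e \in F, e \notin S & a e].
Proof.
move=> lt; have /subsetPn[e] : ~~ ([set e in F | a e] \subset [set e in S | a e]).
  by apply: contraL lt => /subset_leq_card; rewrite -leqNgt.
rewrite !inE => /andP[eF ae]; rewrite ae andbT => eS.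
by exists e.
Qed.

(* If [e] were old, [P] would consist of at least three edges, one of them an
   edge [(s, v_j)]; the detour [s, v_j, t] is then free and ties with [P]. *)
Lemma dummy_last_edge k H S P q e : (l <= k < p)%N ->
  min_cost_edge_set c' s' t' k H S -> lex_min_path c' s' t' H S P ->
  P = rcons q e -> e \notin S -> e \notin H -> tgt e = t' ->
  (forall e0 : edge G, 0 < c e0) \/
  (forall q', lex_min_path c' s' t' H S q' -> (size P <= size q')%N) ->
  ~~ is_old e.
Proof.
move=> /andP[lk kp] hS hP Pe eS eH te hyp; apply/negP=> oe.
have [fS oS sS _] := min_cost_edge_set_optimal aug_cost_ge0 st' hS.
have [eps hg] := gap_exists c'.
have [mP _] := lex_min_shortest hg sS hP; have [pP mP'] := hP.
pose F := symd S [set:: P].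
have oF : optimal c' F by apply: shortest_optimal mP => //; apply: st'.
have fF : flow s' t' k.+1 F.
  by move=> v; rewrite (excess_symd_path _ pP) fS intS mulrDl mul1r addrC.
have [FL fL oL] := optimal_flow_exists.
have lkp : (l <= k <= p)%N by rewrite lk ltnW.
have lk1p : (l <= k.+1 <= p)%N by rewrite kp leqW.
have [aS bS dS cS _] := optimal_high lkp fL oL oS fS.
have [aF bF _ cF posF] := optimal_high lk1p fL oL oF fF.
have inP f : f \in F -> f \notin S -> f \in P.
  by rewrite in_symd => /[swap] /negPf ->; rewrite inE.
(* The count of such edges rises from [k - l] to [k.+1 - l], so [P] must add one; likewise for
   [f2]. *)
have [f1 [f1F f1S f1s]] : exists f, [/\ f \in F, f \notin S & from_source f].
  by apply: num_of_lt; rewrite aS aF subSn.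
have [f2 [f2F f2S f2i]] : exists f, [/\ f \in F, f \notin S & into_old f].
  by apply: num_of_lt; rewrite bS bF subSn.
have f1P := inP _ f1F f1S; have f2P := inP _ f2F f2S.
have eP : e \in P by rewrite Pe mem_rcons inE eqxx.
case: hyp => [posc|ties].
  have tf2 := posF posc f2 f2F f2i.
  have : f2 = e.
    rewrite Pe in pP f2P; apply: (is_path_tgt_end pP f2P).
    by rewrite /= (negPf f2S).
  by move=> h; move: f2i oe; rewrite h; case: (e) => [[[]|]|].
have [j f1E] : exists j, f1 = inl (inr j).
  by case: (f1) f1s => [[//|j]|//] _; exists j.
subst f1; pose g : edge G' := inr (j, exist _ t ts).
(* No edge of [S] enters [v_j]: [S] has no edge between dummies and avoids [(s,v_j)]. An edge of [S]
   leaving [v_j] would unbalance it. *)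
have gS : g \notin S.
  apply/negP=> gS; suff : excess S (inr j) < 0 by rewrite fS /= subrr mulr0 ltxx.
  rewrite /excess (bigD1 g) //= {1}/boundary /= eqxx sub0r.
  apply: (@le_lt_trans _ _ (0 - 1)) => //; rewrite gerDl.
  apply: sumr_le0 => f /andP[fS' _]; suff /negPf tf : @tgt G' f != inr j.
    by rewrite /boundary tf sub0r oppr_le0.
  case: f fS' => [[[f|f]|j']|[j' x]] fS' //=; last by apply: contra f1S => /eqP[<-].
  apply: contraTN isT => _; move/eqP: dS; rewrite cards_eq0 => /eqP/setP.
  by move=> /(_ (inl (inl (inr f)))); rewrite !inE fS'.
have pd : @is_path (residual S) s' t' (from_to j ts).
  rewrite /is_path /= (negPf f1S) (negPf gS) /= !eqxx /= !inE /= andbT.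
  by rewrite eq_sym.
have cd : path_cost (residual_cost c' S) (from_to j ts) = path_cost (residual_cost c' S) P.
  rewrite (@path_cost_symd _ G' c' S P (is_path_uniq pP)) -/F cF cS /path_cost !big_cons big_nil.
  rewrite /residual_cost (negPf f1S) (negPf gS) /= subSn // doubleS.
  by rewrite -[(_.*2.+2)]addn2 natrD; ring.
(* [L] lists new edges of [P]: always [e], and [(s,v_j)] if it is outside [H]. The detour has at
   most as many, [g] taking the place of [e]. *)
have ed : (eta H S (from_to j ts) <= eta H S P)%N.
  pose L : seq (edge G') :=
    e :: (if inl (inr j) \in H then [::] else [:: inl (inr j)]).
  apply: (@leq_trans (size L)).
    by rewrite /eta /= f1S gS /L; case: (_ \in H); case: (_ \in H).
  rewrite /eta -size_filter; apply: uniq_leq_size.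
    by rewrite /L; case: ifP => //= _; rewrite inE andbT; case: (e) oe => [[|]|].
  move=> f; rewrite /L inE mem_filter => /orP[/eqP -> |].
    by rewrite eS eH eP.
  by case: ifP => // /negbT jH; rewrite inE => /eqP ->; rewrite f1S jH f1P.
have /ties : lex_min_path c' s' t' H S (from_to j ts).
  split=> // q' /mP' [lt1|[eq1 le1]]; first by left; rewrite cd.
  by right; rewrite cd; split=> //; apply: leq_trans ed le1.
apply/negP; rewrite -ltnNge.
(* The edges [e], [(s,v_j)] and [f2] are of three different kinds, so [P] is longer than the
   two-edge detour. *)
apply: (@uniq_leq_size _ [:: e; inl (inr j); f2]).
  by case: (e) oe (f2) f2i => [[[]|]|] // a _ [].
by move=> f; rewrite !inE => /or3P[] /eqP ->.
Qed.

(** * Original edges entering a vertex during a run *)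

Section OldInDegree.

Variables (H : nat -> {set edge G'}) (S : nat -> vertex G' -> {set edge G'}).
Variable P : nat -> vertex G' -> seq (edge G').
Hypothesis hrun : run c' s' p H S P.

Notation num_old_in := (num_of (fun f => is_old f && (tgt f == t'))).

Lemma ts' : t' != s'.
Proof. by rewrite eq_sym st'. Qed.

(** An optimal [k]-flow inside [H k] has [k] old edges into [t], and [H k] has only [k] edges into
    [t]. *)
Lemma run_old_indegree_low k : (k <= l)%N -> (k <= p)%N -> num_old_in (H k) = k.
Proof.
move=> kl kp; have [F hF] := run_min_cost_edge_set aug_cost_ge0 hrun kp ts'.
have [fF oF sF iF] := min_cost_edge_set_optimal aug_cost_ge0 st' hF.
have [_ oldF] := optimal_low kl fF oF; have iH := run_indegree hrun kp ts'.
apply/eqP; rewrite eqn_leq -[X in (_ <= X)%N && _]iH -[X in _ && (X <= _)%N]iF.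
apply/andP; split; apply: subset_leq_card.
  by apply/subsetP=> f; rewrite !inE => /and3P[-> _ ->].
by apply/subsetP=> f; rewrite !inE => /andP[fF' ->]; rewrite (subsetP sF) // oldF.
Qed.

Lemma run_old_indegree k :
  (forall e0 : edge G, 0 < c e0) \/ shortest_ties c' s' p H S P ->
  (k <= p)%N -> num_old_in (H k) = minn k l.
Proof.
move=> hyp; elim: k => [|k IH] kp; first by rewrite min0n run_old_indegree_low.
have [kl|lk] := ltnP k l.
  by rewrite (minn_idPl kl) run_old_indegree_low.
rewrite (minn_idPr (leqW lk)); move: (IH (ltnW kp)); rewrite (minn_idPr lk) => <-.
have [e [q [Pe eS eH te]]] := run_last_edge hrun kp ts'.
have [hS hP _] := hrun.2 _ kp.
have eo : ~~ is_old e.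
  apply: (dummy_last_edge _ (hS _ ts') (hP _ ts') Pe eS eH te); first by rewrite lk.
  by case: hyp => [|ties]; [left | right => q' /ties; apply; rewrite ?ts'].
have inE' := run_in_edges hrun kp ts' Pe.
congr #|pred_of_set _|; apply/setP=> f; have /setP/(_ f) := inE'.
rewrite !inE andbCA => ->.
by have [->|_] := eqVneq f e; [rewrite (negPf eo) andbF | rewrite andbCA].
Qed.

End OldInDegree.

End Augment.

(** * Counting edges by their heads *)

Lemma card_sum_indegree (G : digraph) (K : {set edge G}) :
  #|K| = (\sum_v indegree K v)%N.
Proof.
rewrite -sum1_card (partition_big (@tgt G) xpredT) //=; apply: eq_bigr => v _.
by rewrite sum1_card; apply: eq_card => e; rewrite !inE.
Qed.

Lemma indegree_delete_dummies (G : digraph) (s : vertex G) (p : nat)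
    (F : {set edge (augment s p)}) (x : vertex G) :
  indegree (delete_dummies F) x =
    num_of (fun f => is_old f && (tgt f == old_vertex s p x)) F.
Proof.
rewrite /indegree -(card_imset _ (@old_inj G s p)); congr #|pred_of_set _|.
apply/setP=> f; rewrite inE; apply/imsetP/and3P => [[e]|[fF /is_oldP[e fe] /eqP tf]].
  by rewrite !inE => /andP[eF /eqP te] ->; rewrite /= te eqxx eF.
by exists e => //; rewrite !inE -fe fF /=; move: tf; rewrite fe => -[->].
Qed.

Theorem theorem17 (R : realFieldType) (G : digraph) (s : vertex G)
    (c : edge G -> R) (p : nat) (M : R) (lambda : vertex G -> nat)
    (hc : forall e, 0 <= c e) (hp : (0 < p)%N) (hM : \sum_(e : edge G) c e < M)
    (hlambda : forall t, t != s -> max_disjoint_paths s t (lambda t)) :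
  let s' := old_vertex s p s in
  let c' := @aug_cost R G s p c M in
  let sigma t := minn (lambda t) p in
  [/\ never_stuck c' s' p,
      forall (H' : nat -> {set edge (augment s p)})
             (S : nat -> vertex (augment s p) -> {set edge (augment s p)})
             (P : nat -> vertex (augment s p) -> seq (edge (augment s p))),
        run c' s' p H' S P ->
        let H := delete_dummies (H' p) in
        (forall t, t != s -> forall F : {set edge (augment s p)},
           min_cost_edge_set c' s' (old_vertex s p t) (sigma t)
             (H' (sigma t)) F ->
           F \subset [set old_edge s p e | e in H]) /\
        ((forall e, 0 < c e) \/ shortest_ties c' s' p H' S P ->
           #|H| = (\sum_(t | t != s) sigma t)%N)
    & forall K : {set edge G},
        (forall t, t != s -> exists Q : 'I_(sigma t) -> seq (edge G),
           min_cost_paths c s t Q /\ family_edges Q \subset K) ->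
        (\sum_(t | t != s) sigma t <= #|K|)%N].
Proof.
move=> s' c' sigma; have c'0 := aug_cost_ge0 (s := s) (p := p) hc hM; split.
- exact: outconnected_never_stuck c'0 (@aug_connected G s p).
- move=> H' S P hrun H; split=> [t ts F hF|hyp].
    have [fF oF sF _] := min_cost_edge_set_optimal c'0 (st' p ts) hF.
    have [_ oldF] := optimal_low hc hM (hlambda t ts) (geq_minl _ _) fF oF.
    (* The set was taken in round [sigma t <= p], and later rounds only add edges. *)
    have sH := run_subset hrun (geq_minr (lambda t) p) (leqnn p).
    apply/subsetP=> e eF; have /is_oldP[e0 ee] := oldF e eF.
    by rewrite ee imset_f // inE -ee (subsetP sH) // (subsetP sF).
  (* The source contributes nothing, as no round adds an edge into it. *)
  rewrite card_sum_indegree (bigD1 s) //= [X in (X + _)%N](_ : _ = 0%N); last first.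
    apply/eqP; rewrite -leqn0 -(run_indegree_source hrun (leqnn p)).
    rewrite indegree_delete_dummies; apply: subset_leq_card; apply/subsetP=> f.
    by rewrite !inE => /and3P[-> _ ->].
  apply: eq_bigr => t ts; rewrite indegree_delete_dummies /sigma minnC.
  exact: (run_old_indegree hc hM ts (hlambda t ts) hrun hyp (leqnn p)).
- move=> K hK; rewrite card_sum_indegree [leqRHS](bigID (fun t => t != s)) /=.
  apply: leq_trans (leq_addr _ _); apply: leq_sum => t ts.
  have [Q [[dQ _] sQ]] := hK t ts; have st : s != t by rewrite eq_sym.
  rewrite -(indegree_family st dQ); apply: subset_leq_card.
  by apply/subsetP=> f; rewrite !inE => /andP[/(subsetP sQ) -> ->].
Qed.
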